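(* Let $f(x)=x^2+\beta\in\mathbb{Z}[x]$ where $-\beta$ is not a perfect square. Let $a,b\in\mathbb{Q}$ with $0\le a<b$, and let $c,d\in\mathbb{N}$. For each $n\in\mathbb{N}$ let $I(n)=\{k\in\mathbb{N}: an\le k\le bn\}\cap(c\mathbb{N}+d)$ and $F_n=\prod_{k\in I(n)} f(k)$. Let $M\in\mathbb{N}$. Then there exists an effectively computable bound $B\in\mathbb{N}$ such that for all $n>B$ there exists a prime $p>Mn$ that divides $F_n$.
   Context: $\mathbb{N}$ denotes the natural numbers and $c\mathbb{N}+d=\{cm+d: m\in\mathbb{N}\}$. *)

(* Defs.v *)
From mathcomp Require Import all_boot all_order all_algebra finmap.
From mathcomp Require Import boolp classical_sets functions cardinality fsbigop.

Set Implicit Arguments.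
Unset Strict Implicit.
Unset Printing Implicit Defensive.

Import Order.TTheory GRing.Theory Num.Theory.

Local Open Scope classical_set_scope.
Local Open Scope ring_scope.

(* The natural numbers contain 0 throughout, so c N + d = {d, c + d, ...}. *)
Definition progression (c d : nat) : set nat :=
  [set (c * m + d)%N | m in [set: nat]].

Definition index_set (a b : rat) (c d n : nat) : set nat :=
  [set k : nat | a * n%:R <= k%:R <= b * n%:R] `&` progression c d.

Definition quad_poly (beta : int) : {poly int} := 'X^2 + beta%:P.

Definition quad_prod (beta : int) (a b : rat) (c d n : nat) : int :=
  \big[*%R/1]_(k \in index_set a b c d n) (quad_poly beta).[k%:Z].

Lemma finite_index_set (a b : rat) (c d n : nat) :
  finite_set (index_set a b c d n).
Proof.
apply: (@sub_finite_set _ _ `I_(Num.bound (`|b * n%:R|%R : rat))); last exact: finite_II.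
move=> k [/= /andP[_ kb] _]; rewrite -(ltr_nat rat).
exact: le_lt_trans kb (le_lt_trans (ler_norm _) (archi_boundP (normr_ge0 _))).
Qed.

(* Effectivity is expressed with Kleene's partial recursive functions. A code
   carries no arity (RZero denotes the constant 0 of every arity): it has no
   output on argument lists of unsuitable length. *)
Inductive recfun : Type :=
| RZero
| RSucc
| RProj of nat
| RComp of recfun & seq recfun
| RPrec of recfun & recfun
| RMin of recfun.

Definition forall2 (A B : Type) (P : A -> B -> Prop) :=
  fix rec (s : seq A) (t : seq B) {struct s} : Prop :=
    match s, t with
    | [::], [::] => True
    | x :: s', y :: t' => P x y /\ rec s' t'
    | _, _ => False
    end.

(* computes e xs y: the code e halts on the arguments xs with output y. *)
Fixpoint computes (e : recfun) (xs : seq nat) (y : nat) {struct e} : Prop :=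
  match e with
  | RZero => y = 0%N
  | RSucc => exists2 x, xs = [:: x] & y = x.+1
  | RProj i => (i < size xs)%N /\ y = nth 0%N xs i
  | RComp g hs =>
      exists2 ys, forall2 (fun h z => computes h xs z) hs ys & computes g ys y
  | RPrec g h =>
      if xs is x :: xs' then
        (fix loop (n z : nat) {struct n} : Prop :=
           if n is n'.+1
           then exists2 w, loop n' w & computes h [:: n', w & xs'] z
           else computes g xs' z) x y
      else False
  | RMin g =>
      computes g (y :: xs) 0
      /\ forall z, (z < y)%N -> exists v, computes g (z :: xs) v.+1
  end.

Lemma computes_inj (e : recfun) (xs : seq nat) (y1 y2 : nat) :
  computes e xs y1 -> computes e xs y2 -> y1 = y2.
Proof.
move: e xs y1 y2; fix IH 1 => -[||i|g hs|g h|g] xs y1 y2 /=.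
- by move=> -> ->.
- by move=> [x -> ->] [_ [<-] ->].
- by move=> [_ ->] [_ ->].
- move=> [ys1 H1 C1] [ys2 H2 C2].
  suff E : ys1 = ys2 by rewrite E in C1; exact: IH C1 C2.
  elim: hs ys1 ys2 H1 H2 {C1 C2} => [|h hs IHs] [|z1 s1] [|z2 s2] //=.
  by move=> [/IH E1 /IHs E2] [/E1-> /E2->].
- case: xs => // x xs; elim: x y1 y2 => [|x IHx] y1 y2; first exact: IH.
  by move=> [w1 /IHx W C1] [w2 /W E C2]; rewrite -E in C2; exact: IH C1 C2.
- move=> [C1 N1] [C2 N2]; case: (ltngtP y1 y2) => // [/N2|/N1] [v Cv].
  + by have := IH _ _ _ _ C1 Cv.
  + by have := IH _ _ _ _ C2 Cv.
Qed.

(* No sign is recorded for a and b, which are nonnegative in all uses. *)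
Definition encode (beta : int) (a b : rat) (c d M : nat) : seq nat :=
  [:: nat_of_bool (beta < 0); `|beta|%N;
      `|numq a|%N; `|denq a|%N; `|numq b|%N; `|denq b|%N; c; d; M].

(* Main.v *)
Require Import Defs.
From mathcomp Require Import all_boot all_order all_algebra.
From mathcomp Require Import boolp classical_sets fsbigop.
From mathcomp Require Import zify ring lra.

(* Let all prime factors of [prod_k (k^2 + beta)], [k] running over an arithmetic
   progression of [m] terms inside [I(n)], be at most [y = O(m)].  Discarding for
   each prime the term of highest valuation (Erdős), the [p]-adic valuation of
   the product is at most that of [(m!)^2] up to harmless terms, and it is [0] if
   [p] is inert, i.e. divides no value of [x^2 + beta].  As the product is at
   least [(m!)^2 / O(1)^m], and the discarded terms contribute [O(1)^m] by
   Chebyshev's bound on [pi(y)], the inert part of [(m!)^2] is [O(1)^m], so that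
   [prod_(p <= m inert) p / (p - 1)] is bounded.

   On the other hand this product is unbounded.  By Thue's lemma, a root of
   [x^2 + beta] modulo a squarefree [v <= N^2] yields [S, T <= N] with
   [v | S^2 + beta T^2], boundedly many roots giving the same [(S, T)]; hence the
   sum of [1 / v] over all such roots is [O(H(N))], [H] being the harmonic sum.
   If [A] is the sum of [1 / v] over the squarefree [v <= N] all of whose primes
   split, then [A^2] is at most twice that sum, because a product of two coprime
   such numbers has at least as many roots as divisors.  Finally
   [H(N) <= O(A) * prod_(p <= N inert) p / (p - 1)], so [H(N)] is at most a
   constant times the square of that product.  All constants are explicit. *)

Set Implicit Arguments.
Unset Strict Implicit.
Unset Printing Implicit Defensive.

Import Order.TTheory GRing.Theory Num.Theory.

Local Open Scope ring_scope.

(** * Harmonic sums *)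

(* The term [n = 0] vanishes, since [0^-1 = 0]. *)
Definition harmonic (N : nat) : rat := \sum_(n < N.+1) n%:R^-1.

Lemma sum_le_inj (I J : finType) (P : pred I) (Q : pred J) (f : I -> J)
    (F : I -> rat) (G : J -> rat) :
  (forall i, P i -> Q (f i)) -> (forall i, P i -> F i <= G (f i)) ->
  (forall i j, P i -> P j -> f i = f j -> i = j) ->
  (forall j, Q j -> 0 <= G j) ->
  \sum_(i | P i) F i <= \sum_(j | Q j) G j.
Proof.
move=> fQ FG finj G0.
apply: (le_trans (ler_sum _ FG)).
pose A := [set i | P i].
have -> : \sum_(i | P i) G (f i) = \sum_(j in f @: A) G j.
  rewrite big_imset /=; last first.
    by move=> i j; rewrite !inE; apply: finj.
  by apply: eq_bigl => i; rewrite inE.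
rewrite [leRHS](bigID (fun j => j \in f @: A)) /=.
rewrite -[leLHS]addr0 lerD //; last first.
  by apply: sumr_ge0 => j /andP[/G0].
rewrite le_eqVlt; apply/orP; left; apply/eqP; apply: eq_bigl => j.
case: imsetP => [[i iA ->]|]; last by rewrite andbF.
by rewrite fQ //; rewrite inE in iA.
Qed.

Lemma sum_inv_sqr_le2 (N : nat) : \sum_(n < N.+1) (n%:R ^+ 2)^-1 <= 2 :> rat.
Proof.
(* The sharper bound [2 - 1/N] telescopes, as [1/(x+1)^2 <= 1/x - 1/(x+1)]. *)
suff H : N != 0%N -> \sum_(n < N.+1) (n%:R ^+ 2)^-1 <= 2 - N%:R^-1 :> rat.
  case: N H => [|N] H; first by rewrite big_ord1 expr0n /= invr0.
  apply: le_trans (H isT) _; rewrite lerBlDr lerDl invr_ge0; exact: ler0n.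
elim: N => // -[_ _|N IH _]; first by rewrite !big_ord_recr big_ord0 /=; lra.
rewrite big_ord_recr /=; apply: (le_trans (lerD (IH isT) (lexx _))).
set x : rat := N.+1%:R; have x0 : 0 < x by rewrite ltr0n.
have -> : N.+2%:R = x + 1 :> rat by rewrite -natr1.
rewrite -subr_ge0.
have -> : 2 - (x + 1)^-1 - (2 - x^-1 + ((x + 1) ^+ 2)^-1) = (x * (x+1)^+2)^-1.
  by field; apply/andP; split; lra.
by rewrite invr_ge0 mulr_ge0 ?sqr_ge0 // ltW.
Qed.

(** Oresme's grouping: each of the [2^j] terms with [2^j < n <= 2^(j+1)] is at least [1/2^(j+1)], so
    every dyadic block adds at least 1/2. *)
Lemma harmonic_pow2 (j : nat) : j%:R / 2 <= harmonic (2 ^ j).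
Proof.
elim: j => [|j IH]; first by rewrite mul0r; apply: sumr_ge0 => i _; rewrite invr_ge0 ler0n.
rewrite -natr1 mulrDl mul1r /harmonic.
rewrite -(big_mkord predT (fun n => n%:R^-1)) /=.
rewrite (@big_cat_nat _ _ _ (2 ^ j).+1) //=; last by rewrite ltnS leq_exp2l.
rewrite big_mkord; apply: lerD => //.
apply: (@le_trans _ _ (\sum_((2 ^ j).+1 <= i < (2 ^ j.+1).+1) (2 ^ j.+1)%:R^-1)).
  rewrite big_const_nat iter_addr_0 -mulr_natl.
  have -> : ((2 ^ j.+1).+1 - (2 ^ j).+1 = 2 ^ j)%N by rewrite expnS; lia.
  rewrite expnS natrM.
  have : (2 ^ j)%:R != 0 :> rat by rewrite pnatr_eq0 expn_eq0.
  move=> h; rewrite le_eqVlt; apply/orP; left; apply/eqP; field; exact: h.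
apply: ler_sum_nat => i /andP[i1 i2].
rewrite lef_pV2 ?ler_nat ?qualifE /= ?ltr0n ?expn_gt0 //; lia.
Qed.

Lemma harmonic_mono (M N : nat) : (M <= N)%N -> harmonic M <= harmonic N.
Proof.
move=> MN; rewrite /harmonic -2!(big_mkord predT (fun n => n%:R^-1)).
rewrite (@big_cat_nat _ _ _ M.+1 0 N.+1) //= lerDl.
by apply: sumr_ge0 => i _; rewrite invr_ge0 ler0n.
Qed.

(** Division by [p] injects the multiples of [p] into the same range, so the full sum [X] and the
    sum [Y] over non-multiples satisfy [X <= Y + X/p]. *)
Lemma sift_prime_le (N p : nat) (P : pred nat) : prime p ->
  (forall n, P (p * n)%N -> P n) ->
  \sum_(n < N.+1 | P n) (n%:R^-1 : rat) <=
  p%:R / (p.-1)%:R * \sum_(n < N.+1 | P n && ~~ (p %| n)%N) n%:R^-1.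
Proof.
move=> pp Pp; set X := (X in X <= _); set Y := \sum_(_ < _ | _ && _) _.
have p1 := prime_gt1 pp.
suff h : X <= Y + p%:R^-1 * X.
  have e : p%:R = (p.-1)%:R + 1 :> rat by rewrite natr1 prednK //; lia.
  have q0 : 0 < (p.-1)%:R :> rat by rewrite ltr0n; lia.
  have p0 : p%:R != 0 :> rat by rewrite pnatr_eq0; lia.
  rewrite mulrAC ler_pdivlMr //.
  have := ler_wpM2l (ler0n rat p) h; rewrite mulrDr mulrA divff // mul1r.
  rewrite e; lra.
rewrite {1}/X (bigID (fun n : 'I_N.+1 => (p %| n)%N)) /= addrC lerD //.
rewrite mulr_sumr.
pose f (n : 'I_N.+1) : 'I_N.+1 := inord (n %/ p).
have fE (n : 'I_N.+1) : (f n = n %/ p :> nat)%N.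
  by rewrite inordK //; apply: leq_ltn_trans (leq_div _ _) (ltn_ord n).
apply: (sum_le_inj (f := f)) => [i /andP[Pi pi]|i /andP[Pi pi]|i j /andP[_ pi] /andP[_ pj]|j _].
- by rewrite fE; apply: Pp; rewrite mulnC divnK.
- by rewrite fE -invfM -natrM mulnC divnK.
- move=> /(congr1 val) /=; rewrite !fE => e; apply: val_inj => /=.
  by rewrite -(divnK pi) e divnK.
- by rewrite mulr_ge0 // invr_ge0 ler0n.
Qed.

Lemma sift_primes_le (N : nat) (s : seq nat) : all prime s ->
  harmonic N <= \prod_(p <- s) (p%:R / (p.-1)%:R) *
    \sum_(n < N.+1 | all (fun p => ~~ (p %| n)%N) s) n%:R^-1.
Proof.
elim: s => [_|p s IH /= /andP[pp /IH{}IH]].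
  by rewrite big_nil mul1r.
apply: (le_trans IH); rewrite big_cons [leRHS]mulrAC [leRHS]mulrC.
apply: ler_wpM2l; first by apply: prodr_ge0 => i _; rewrite divr_ge0.
rewrite (eq_bigl (fun n : 'I_N.+1 => all (fun q => ~~ (q %| n)%N) s && ~~ (p %| n)%N)); last first.
  by move=> n; rewrite andbC.
apply: (sift_prime_le N (P := fun n => all (fun q => ~~ (q %| n)%N) s)) => // n.
move=> /allP H; apply/allP => q /H; apply: contra => h; exact: dvdn_mull.
Qed.

(** * Squarefree numbers *)

(** For [v = 0] the choice [g = 0] violates the condition, so positivity is built in. *)
Definition sqfree (v : nat) : bool :=
  [forall g : 'I_v.+1, (g * g %| v)%N ==> (g == 1 :> nat)%N].

Lemma sqfreeP (v : nat) :
  reflect ((0 < v)%N /\ forall g, (g * g %| v)%N -> g = 1%N) (sqfree v).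
Proof.
apply: (iffP forallP) => [H|[v0 H] g]; last by apply/implyP => /H ->.
have v0 : (0 < v)%N.
  by case: v H => // /(_ ord0).
split=> // g gv.
have gle : (g < v.+1)%N.
  by rewrite ltnS; apply: dvdn_leq => //; apply: dvdn_trans gv; exact: dvdn_mulr.
by have /implyP/(_ gv)/eqP := H (Ordinal gle).
Qed.

Lemma sqfree_gt0 (v : nat) : sqfree v -> (0 < v)%N.
Proof. by case/sqfreeP. Qed.

Lemma sqfree_dvd (u v : nat) : (u %| v)%N -> sqfree v -> sqfree u.
Proof.
move=> uv /sqfreeP[v0 H]; apply/sqfreeP; split; first exact: dvdn_gt0 uv.
by move=> g /dvdn_trans/(_ uv)/H.
Qed.

(** A prime whose square divides [u * v] divides only one of the coprime factors, so its square
    divides that factor. *)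
Lemma sqfreeM (u v : nat) : coprime u v -> sqfree u -> sqfree v -> sqfree (u * v).
Proof.
move=> cuv /sqfreeP[u0 Hu] /sqfreeP[v0 Hv]; apply/sqfreeP.
split; first by rewrite muln_gt0 u0.
move=> h huv; have h0 : (0 < h)%N.
  by case: h huv => //; rewrite dvd0n muln_eq0; lia.
have [] := ltnP 1 h; last by lia.
move=> h1; have pp := pdiv_prime h1; set p := pdiv h in pp.
have ppuv : (p * p %| u * v)%N.
  by apply: dvdn_trans huv; apply: dvdn_mul; exact: pdiv_dvd.
have pq a b : coprime a b -> (forall g, (g * g %| a)%N -> g = 1%N) ->
    (p * p %| a * b)%N -> (p %| a)%N -> p = 1%N.
  move=> cab Ha d pa; apply: Ha.
  have cpb := coprime_dvdl pa cab.
  by rewrite -(@Gauss_dvdl _ a b) // coprimeMl cpb.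
have [pu|pu] := boolP (p %| u)%N.
  by have := pq _ _ cuv Hu ppuv pu; have := prime_gt1 pp; lia.
have pv : (p %| v)%N.
  have : (p %| u * v)%N by apply: dvdn_trans ppuv; exact: dvdn_mulr.
  by rewrite Euclid_dvdM // (negbTE pu).
rewrite coprime_sym in cuv; rewrite mulnC in ppuv.
by have := pq _ _ cuv Hv ppuv pv; have := prime_gt1 pp; lia.
Qed.

Lemma sqfree_mul_coprime (u v : nat) : sqfree (u * v) -> coprime u v.
Proof.
move=> /sqfreeP[_ H]; rewrite /coprime; apply/eqP; apply: H.
by apply: dvdn_mul; [exact: dvdn_gcdl | exact: dvdn_gcdr].
Qed.

Definition sqpart (n : nat) : nat := \max_(g < n.+1 | (g * g %| n)%N) g.

Lemma sqpart_dvd (n : nat) : (0 < n)%N -> (sqpart n * sqpart n %| n)%N.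
Proof.
move=> n0; rewrite /sqpart.
have h1 : (1 < n.+1)%N by lia.
have : (0 < #|[pred g : 'I_n.+1 | (g * g %| n)%N]|)%N.
  by apply/card_gt0P; exists (Ordinal h1); rewrite inE /= dvd1n.
by case/(eq_bigmax_cond (fun g : 'I_n.+1 => g : nat)) => g; rewrite inE => gn ->.
Qed.

(** If [h^2] divides the quotient, then [h * sqpart n] competes in the maximum defining [sqpart n],
    which forces [h = 1]. *)
Lemma sqfree_sqpart (n : nat) : (0 < n)%N ->
  sqfree (n %/ (sqpart n * sqpart n)).
Proof.
move=> n0; have d := sqpart_dvd n0; set g := sqpart n in d *.
have ggn : (n %/ (g * g) * (g * g) = n)%N by rewrite divnK.
have q0 : (0 < n %/ (g * g))%N by rewrite divn_gt0; [exact: dvdn_leq | exact: dvdn_gt0 d].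
have g0 : (0 < g)%N by have := dvdn_gt0 n0 d; rewrite muln_gt0 => /andP[].
apply/sqfreeP; split => // h hq.
have h0 : (0 < h)%N by have := dvdn_gt0 q0 hq; rewrite muln_gt0 => /andP[].
have hg : ((h * g) * (h * g) %| n)%N.
  by rewrite mulnACA -ggn; apply: dvdn_mul.
have lt : (h * g < n.+1)%N.
  by rewrite ltnS; apply: dvdn_leq => //; apply: dvdn_trans hg; exact: dvdn_mulr.
have : (h * g <= g)%N.
  exact: (@leq_bigmax_cond _ _ (fun i : 'I_n.+1 => i : nat) (Ordinal lt)).
by nia.
Qed.

Lemma sum_inv_gt0 (N : nat) (P : pred nat) :
  \sum_(n < N.+1 | P n) n%:R^-1 = \sum_(n < N.+1 | P n && (0 < n)%N) n%:R^-1 :> rat.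
Proof.
rewrite (bigID (fun n : 'I_N.+1 => (0 < n)%N)) /= [X in _ + X]big1 ?addr0 //.
by move=> n /andP[_]; rewrite -leqNgt leqn0 => /eqP ->; rewrite invr0.
Qed.

(** Writing [n = g^2 v] with [v] squarefree bounds the sum by the product of the sums of [1/g^2] and
    of [1/v]; the first is at most 2. *)
Lemma sum_inv_sqfree_le (N : nat) (P : pred nat) :
  (forall a b, P (a * b)%N -> P b) ->
  \sum_(n < N.+1 | P n) (n%:R^-1 : rat) <=
  2 * \sum_(v < N.+1 | P v && sqfree v) v%:R^-1.
Proof.
move=> Pd; rewrite sum_inv_gt0.
apply: (@le_trans _ _ ((\sum_(n < N.+1) (n%:R ^+ 2)^-1) *
   \sum_(v < N.+1 | P v && sqfree v) (v%:R^-1))); last first.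
  apply: ler_wpM2r; last exact: sum_inv_sqr_le2.
  by apply: sumr_ge0 => v _; rewrite invr_ge0 ler0n.
rewrite big_distrlr /= pair_big /=.
pose f (n : 'I_N.+1) : 'I_N.+1 * 'I_N.+1 :=
  (inord (sqpart n), inord (n %/ (sqpart n * sqpart n))).
have fE (n : 'I_N.+1) : (0 < n)%N -> ((f n).1 = sqpart n :> nat)%N /\
    ((f n).2 = n %/ (sqpart n * sqpart n) :> nat)%N.
  move=> n0; have := ltn_ord n; have := sqpart_dvd n0; move=> /[dup] d /(dvdn_leq n0) l.
  have g0 : (0 < sqpart n)%N by have := dvdn_gt0 n0 d; rewrite muln_gt0 => /andP[].
  move=> nN; have l1 : (n %/ (sqpart n * sqpart n) < N.+1)%N.
    by apply: leq_ltn_trans nN; exact: leq_div.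
  have l2 : (sqpart n < N.+1)%N by move: l nN g0; set s := sqpart n; nia.
  by rewrite /f /= !inordK.
apply: (sum_le_inj (f := f)) => [i|i|i j|j].
- move=> /andP[Pi i0]; have [_ ->] := fE _ i0.
  rewrite sqfree_sqpart // andbT; apply: (Pd (sqpart i * sqpart i)%N).
  by rewrite mulnC divnK // sqpart_dvd.
- move=> /andP[Pi i0]; have [-> ->] := fE _ i0.
  by rewrite -invfM expr2 -!natrM mulnC divnK // sqpart_dvd.
- move=> /andP[_ i0] /andP[_ j0] e; apply: val_inj => /=.
  have [e1 e2] := fE _ i0; have [e3 e4] := fE _ j0.
  rewrite -(divnK (sqpart_dvd i0)) -(divnK (sqpart_dvd j0)).
  by rewrite -e2 -e4 -e1 -e3 e.
- by rewrite mulr_ge0 // invr_ge0 ?sqr_ge0 ?ler0n.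
Qed.

(** * Square roots of [- beta] modulo squarefree numbers *)

(** With the absolute value, [v %| qval beta x] is convertible to divisibility of [x^2 + beta] in
    [int]; the proofs below switch freely between the two. *)
Definition qval (beta : int) (x : nat) : nat := absz (x%:Z ^+ 2 + beta).

Lemma dvdn_qval_mod (beta : int) (v x y : nat) :
  x = y %[mod v] -> (v %| qval beta x)%N = (v %| qval beta y)%N.
Proof.
move=> e.
have : (v%:Z %| x%:Z - y%:Z)%Z.
  by rewrite -eqz_mod_dvd; apply/eqP; rewrite !modz_nat e.
move=> d; rewrite -[LHS]/(v%:Z %| x%:Z ^+ 2 + beta)%Z -[RHS]/(v%:Z %| y%:Z ^+ 2 + beta)%Z.
have -> : x%:Z ^+ 2 + beta = (x%:Z - y%:Z) * (x%:Z + y%:Z) + (y%:Z ^+ 2 + beta) by ring.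
by rewrite rpredDl // dvdz_mulr.
Qed.

Lemma chinese_root (beta : int) (w1 w2 x1 x2 : nat) : coprime w1 w2 ->
  (w1 %| qval beta x1)%N -> (w2 %| qval beta x2)%N ->
  (w1 * w2 %| qval beta (chinese w1 w2 x1 x2))%N.
Proof.
move=> c h1 h2; rewrite Gauss_dvd //.
rewrite (dvdn_qval_mod beta (chinese_modl c x1 x2)) h1.
by rewrite (dvdn_qval_mod beta (chinese_modr c x1 x2)) h2.
Qed.

(** The factor [w.-1] stands for -1 modulo [w], which keeps negation inside [nat]. *)
Lemma dvdn_qval_opp (beta : int) (w r : nat) : (0 < w)%N ->
  (w %| qval beta (w.-1 * r))%N = (w %| qval beta r)%N.
Proof.
move=> w0.
rewrite -[LHS]/(w%:Z %| (w.-1 * r)%N%:Z ^+ 2 + beta)%Z -[RHS]/(w%:Z %| r%:Z ^+ 2 + beta)%Z.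
have -> : (w.-1 * r)%N%:Z = (w%:Z - 1) * r%:Z.
  by rewrite PoszM -predn_int.
have -> : ((w%:Z - 1) * r%:Z) ^+ 2 + beta =
   w%:Z * ((w%:Z - 2) * r%:Z ^+ 2) + (r%:Z ^+ 2 + beta) by ring.
by rewrite rpredDl // dvdz_mulr.
Qed.

(* The root of [x^2 + beta] modulo [w1 * w2] that agrees with [r] modulo [w1]
   and with [- r] modulo [w2] determines [w1]. *)
Lemma gcdn_chinese_root (beta : int) (w1 w2 r : nat) :
  (0 < w1)%N -> (0 < w2)%N -> coprime w1 w2 ->
  coprime (w1 * w2) (2 * `|beta|) -> (w1 * w2 %| qval beta r)%N ->
  gcdn (w1 * w2)
    (chinese w1 w2 r (w2.-1 * r) %% (w1 * w2) + (w1 * w2).-1 * r) = w1.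
Proof.
(* [e] represents [x - r] modulo [w1 * w2]: it is 0 modulo [w1] and [- 2 r] modulo [w2]. *)
move=> w10 w20 c cb rr; set x := chinese _ _ _ _; set e := (_ + _)%N.
have w0 : (0 < w1 * w2)%N by rewrite muln_gt0 w10.
have he h y : (h %| w1 * w2)%N -> x = y %[mod h] -> (e + r = y %[mod h])%N.
  move=> hw hx; rewrite /e -addnA.
  have -> : ((w1 * w2).-1 * r + r = w1 * w2 * r)%N by rewrite -mulSnr prednK.
  have h0 : (h %| w1 * w2 * r)%N by exact: dvdn_mulr.
  by rewrite -modnDmr (eqP h0) addn0 modn_dvdm.
have d1 : (w1 %| e)%N.
  have := he w1 r (dvdn_mulr _ (dvdnn _)) (chinese_modl c _ _).
  rewrite -{2}[r]add0n => /eqP; rewrite eqn_modDr => /eqP; rewrite mod0n => H.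
  by apply/eqP.
have d2 : (w2 %| e + 2 * r)%N.
  have := he w2 (w2.-1 * r)%N (dvdn_mull _ (dvdnn _)) (chinese_modr c _ _).
  move=> /eqP; rewrite -(eqn_modDr r) => /eqP; rewrite -mulSnr prednK // modnMr => H.
  by apply/eqP; rewrite mul2n -addnn addnA.
(* A common divisor of [w2] and [e] divides [2 r] and [r^2 + beta], hence
   [4 beta = 4 (r^2 + beta) - (2 r)^2]; being prime to [2 beta], it is 1. *)
have c2 : coprime w2 e.
  set h := gcdn w2 e; have hw : (h %| w2)%N by exact: dvdn_gcdl.
  have hr : (h %| 2 * r)%N.
    by rewrite -(dvdn_addr _ (dvdn_gcdr w2 e)) (dvdn_trans hw).
  have hq : (h %| qval beta r)%N.
    by apply: dvdn_trans rr; apply: dvdn_mull.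
  have hb : (h %| 2 * (2 * `|beta|))%N.
    have : (h%:Z %| 2 * (2 * beta))%Z.
      have -> : 2 * (2 * beta) = 4 * (r%:Z ^+ 2 + beta) - (2 * r%:Z) * (2 * r%:Z) by ring.
      rewrite rpredB // dvdz_mull // dvdzE.
    by rewrite dvdzE /= !abszM.
  have ch : coprime h (2 * `|beta|).
    by apply: coprime_dvdl cb; apply: dvdn_mull.
  move: hb; rewrite Gauss_dvdl // => h2.
  have : (h %| 2 * `|beta|)%N by rewrite dvdn_mulr.
  by move=> /gcdn_idPl; rewrite /coprime -/h in ch *; rewrite (eqP ch) => <-.
have /dvdnP[q eq] := d1; rewrite eq [(q * w1)%N]mulnC -muln_gcdr.
have : coprime w2 q by apply: coprime_dvdr c2; rewrite eq dvdn_mulr.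
by rewrite /coprime => /eqP ->; rewrite muln1.
Qed.

Definition has_root (beta : int) (v : nat) : bool :=
  has (fun x => (v %| qval beta x)%N) (iota 0 v).

Definition root_of (beta : int) (v : nat) : nat :=
  find (fun x => (v %| qval beta x)%N) (iota 0 v).

Lemma root_ofP (beta : int) (v : nat) :
  has_root beta v -> (v %| qval beta (root_of beta v))%N.
Proof.
move=> /[dup] h /(nth_find 0%N); rewrite nth_iota; first by rewrite add0n.
by rewrite -[X in (_ < X)%N](size_iota 0 v) -has_find.
Qed.

Lemma has_rootI (beta : int) (v x : nat) : (0 < v)%N ->
  (v %| qval beta x)%N -> has_root beta v.
Proof.
move=> v0 vx; apply/hasP; exists (x %% v)%N.
  by rewrite mem_iota /= add0n ltn_pmod.
by rewrite (@dvdn_qval_mod beta v _ x) // modn_mod.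
Qed.

Lemma has_rootM (beta : int) (u v : nat) : (0 < u)%N -> (0 < v)%N ->
  coprime u v -> has_root beta u -> has_root beta v -> has_root beta (u * v).
Proof.
move=> u0 v0 c /root_ofP hu /root_ofP hv.
by apply: has_rootI (chinese_root c hu hv); rewrite muln_gt0 u0.
Qed.

Lemma has_root_dvd (beta : int) (u v : nat) : (0 < u)%N -> (u %| v)%N ->
  has_root beta v -> has_root beta u.
Proof.
by move=> u0 uv /root_ofP h; apply: has_rootI u0 (dvdn_trans uv h).
Qed.

(** * Sums over split squarefree numbers *)

(** For [- beta] not a square, these are the products of distinct primes, prime to [2 beta], that
    split in the quadratic field of [sqrt(- beta)]. *)
Definition splitting (beta : int) (v : nat) : bool :=
  [&& sqfree v, coprime v (2 * `|beta|) & has_root beta v].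

Lemma splittingM (beta : int) (u v : nat) : coprime u v ->
  splitting beta u -> splitting beta v -> splitting beta (u * v).
Proof.
move=> c /and3P[su cu ru] /and3P[sv cv rv].
rewrite /splitting sqfreeM // coprimeMl cu cv /=.
by apply: has_rootM => //; exact: sqfree_gt0.
Qed.

Lemma splitting_dvd (beta : int) (u v : nat) : (u %| v)%N ->
  splitting beta v -> splitting beta u.
Proof.
move=> uv /and3P[sv cv rv]; have su := sqfree_dvd uv sv.
rewrite /splitting su (coprime_dvdl uv cv) /=.
exact: has_root_dvd (sqfree_gt0 su) uv rv.
Qed.

Definition root_sum (beta : int) (X : nat) : rat :=
  \sum_(vx : 'I_X.+1 * 'I_X.+1 |
     [&& sqfree vx.1, (vx.2 < vx.1)%N & (vx.1 %| qval beta vx.2)%N])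
    vx.1%:R^-1.

(** A pair [(u1, u2)] with gcd [g] is [(g w1, g w2)], and [1/(u1 u2) = 1/g^2 * 1/(w1 w2)]. It is
    sent to [g] and the root modulo [w1 w2] that is [r] modulo [w1] and [- r] modulo [w2], where [r]
    is a fixed root. The factor 2 bounds the sum of [1/g^2]. *)
Lemma splitting_sum_sqr_le (beta : int) (N : nat) :
  (\sum_(v < N.+1 | splitting beta v) v%:R^-1) ^+ 2 <=
  2 * root_sum beta (N * N).
Proof.
apply: (@le_trans _ _ ((\sum_(n < N.+1) (n%:R ^+ 2)^-1) * root_sum beta (N * N))); last first.
  apply: ler_wpM2r; last exact: sum_inv_sqr_le2.
  by apply: sumr_ge0 => v _; rewrite invr_ge0 ler0n.
rewrite expr2 /root_sum !big_distrlr /= !pair_big /=.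
pose w1 (u : 'I_N.+1 * 'I_N.+1) := (u.1 %/ gcdn u.1 u.2)%N.
pose w2 (u : 'I_N.+1 * 'I_N.+1) := (u.2 %/ gcdn u.1 u.2)%N.
pose v u := (w1 u * w2 u)%N.
pose x u := (chinese (w1 u) (w2 u) (root_of beta (v u))
               ((w2 u).-1 * root_of beta (v u)) %% v u)%N.
pose f (u : 'I_N.+1 * 'I_N.+1) : 'I_N.+1 * ('I_(N * N).+1 * 'I_(N * N).+1) :=
  (inord (gcdn u.1 u.2), (inord (v u), inord (x u))).
pose P (u : 'I_N.+1 * 'I_N.+1) := splitting beta u.1 && splitting beta u.2.
have main u : P u -> [/\ (w1 u * gcdn u.1 u.2 = u.1)%N, (w2 u * gcdn u.1 u.2 = u.2)%N,
   coprime (w1 u) (w2 u), splitting beta (v u) & (v u <= N * N)%N].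
  move=> /andP[s1 s2].
  have [/sqfree_gt0 p1 _ _] := and3P s1; have [/sqfree_gt0 p2 _ _] := and3P s2.
  have g0 : (0 < gcdn u.1 u.2)%N by rewrite gcdn_gt0 p1.
  have e1 : (w1 u * gcdn u.1 u.2 = u.1)%N by rewrite divnK // dvdn_gcdl.
  have e2 : (w2 u * gcdn u.1 u.2 = u.2)%N by rewrite divnK // dvdn_gcdr.
  have c : coprime (w1 u) (w2 u).
    have : (gcdn (w1 u) (w2 u) * gcdn u.1 u.2 == 1 * gcdn u.1 u.2)%N.
      by rewrite muln_gcdl e1 e2 mul1n.
    by rewrite eqn_pmul2r.
  split=> //.
    apply: splittingM => //.
      by apply: splitting_dvd s1; rewrite -[X in (_ %| X)%N]e1 dvdn_mulr.
    by apply: splitting_dvd s2; rewrite -[X in (_ %| X)%N]e2 dvdn_mulr.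
  have l1 : (w1 u <= u.1)%N by exact: leq_div.
  have l2 : (w2 u <= u.2)%N by exact: leq_div.
  have := ltn_ord u.1; have := ltn_ord u.2; rewrite !ltnS => a b.
  by apply: leq_mul; [exact: leq_trans b | exact: leq_trans a].
have vpos u : P u -> (0 < v u)%N.
  by move=> /main[_ _ _ /and3P[/sqfree_gt0]].
have fE u : P u -> [/\ (f u).1 = gcdn u.1 u.2 :> nat, (f u).2.1 = v u :> nat
    & (f u).2.2 = x u :> nat].
  move=> Pu; have [e1 e2 c s l] := main u Pu; have v0 := vpos u Pu.
  rewrite /f /= !inordK //.
    by rewrite ltnS; apply: leq_trans l; apply: ltnW; rewrite ltn_pmod.
  have [/andP[s1 _]] := (Pu); have [/sqfree_gt0 p1 _ _] := and3P s1.
  by apply: leq_ltn_trans (ltn_ord u.1); apply: dvdn_leq => //; exact: dvdn_gcdl.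
apply: (sum_le_inj (f := f)) => [u|u|u u'|u].
- move=> Pu; have [_ -> ->] := fE u Pu; have [e1 e2 c s l] := main u Pu.
  have v0 := vpos u Pu; have [sv _ /root_ofP rv] := and3P s.
  rewrite sv ltn_pmod //=.
  rewrite (@dvdn_qval_mod beta _ _ (chinese (w1 u) (w2 u) (root_of beta (v u))
               ((w2 u).-1 * root_of beta (v u)))) ?modn_mod //.
  have w0 : (0 < w2 u)%N by move: v0; rewrite muln_gt0 => /andP[].
  apply: chinese_root => //; first by apply: dvdn_trans rv; apply: dvdn_mulr.
  by rewrite dvdn_qval_opp //; apply: dvdn_trans rv; apply: dvdn_mull.
- move=> Pu; have [-> -> _] := fE u Pu; have [e1 e2 c s l] := main u Pu.
  by rewrite -!invfM -!natrM -natrX -natrM /v -mulnn mulnACA ![(gcdn _ _ * _)%N]mulnC e1 e2.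
- move=> Pu Pu' e.
  have [a1 a2 a3] := fE u Pu; have [b1 b2 b3] := fE u' Pu'.
  rewrite e b1 in a1; rewrite e b2 in a2; rewrite e b3 in a3.
  (* Injectivity: [v] and [x] return [w1] as a gcd, then [w2 = v / w1], and multiplying by [g]
     restores the pair. *)
  have rec t : P t -> gcdn (v t) (x t + (v t).-1 * root_of beta (v t)) = w1 t.
    move=> Pt; have [e1 e2 c /and3P[_ cb /root_ofP rv] l] := main t Pt.
    have := vpos t Pt; rewrite {1}/v muln_gt0 => /andP[p1 p2].
    exact: (gcdn_chinese_root p1 p2 c cb rv).
  have r1 := rec _ Pu; rewrite -a2 -a3 rec // in r1.
  have [e1 e2 _ _ _] := main u Pu; have [e1' e2' _ _ _] := main u' Pu'.
  have := vpos _ Pu'; rewrite {1}/v muln_gt0 => /andP[p1 p2].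
  have r2 : w2 u' = w2 u.
    apply/eqP; rewrite -(eqn_pmul2l p1); apply/eqP.
    by rewrite -/(v u') a2 /v r1.
  move: e1 e2; rewrite -r1 -r2 -a1 e1' e2' => f1 f2.
  by apply/pair_eqP => /=; apply/andP; split; apply/eqP/val_inj.
- by rewrite mulr_ge0 // invr_ge0 ?sqr_ge0 ?ler0n.
Qed.

(** * Thue's lemma *)

Lemma sqrtn_exists (v : nat) : exists k, (k * k <= v < k.+1 * k.+1)%N.
Proof.
elim: v => [|v [k /andP[k1 k2]]]; first by exists 0%N.
have [h|h] := ltnP v.+1 (k.+1 * k.+1); first by exists k; lia.
by exists k.+1; lia.
Qed.

(** Pigeonhole: with [k] the integer square root of [v], the [(k+1)^2 > v] values [i + x j] for
    [i, j <= k] collide modulo [v]. [S] and [T] are the absolute differences of the coordinates, and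
    [b] tells whether the coordinates move in opposite directions. *)
Lemma thue (v x : nat) : (0 < v)%N ->
  exists S T b, [/\ (0 < S + T)%N, (S * S <= v)%N, (T * T <= v)%N &
    if b then S == x * T %[mod v] else (v %| S + x * T)%N].
Proof.
case: v => // v _; have [k /andP[k1 k2]] := sqrtn_exists v.+1.
pose h (u : 'I_k.+1 * 'I_k.+1) : 'I_v.+1 := inord ((u.1 + x * u.2) %% v.+1).
have : ~~ injectiveb h.
  apply/negP => /injectiveP/leq_card; rewrite card_prod !card_ord; lia.
move=> /injectivePn[[i j] [[i' j'] ne /(congr1 val)]] /=.
rewrite !inordK ?ltn_pmod // => e.
wlog le : i j i' j' ne e / (i <= i')%N.
  move=> H; have [l|/ltnW l] := leqP i i'; first exact: (H i j i' j').
  by apply: (H i' j' i j) => //; rewrite eq_sym.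
have := ltn_ord i'; have := ltn_ord j'; have := ltn_ord j; rewrite !ltnS => a1 a2 a3.
have sq a : (a <= k)%N -> (a * a <= v.+1)%N by move=> ak; apply: leq_trans k1; exact: leq_mul.
have [l|/ltnW l] := leqP j j'.
  exists (i' - i)%N, (j' - j)%N, false; split.
  - rewrite lt0n; apply: contra ne; rewrite addn_eq0 !subn_eq0 => /andP[h1 h2].
    by rewrite xpair_eqE -!val_eqE /= !eqn_leq le l h1 h2.
  - by apply: sq; apply: leq_trans a3; exact: leq_subr.
  - by apply: sq; apply: leq_trans a2; exact: leq_subr.
  move/eqP: e; rewrite eq_sym eqn_mod_dvd; last by apply: leq_add => //; rewrite leq_mul2l l orbT.
  suff -> : (i' + x * j' - (i + x * j) = i' - i + x * (j' - j))%N by [].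
  by rewrite mulnBr; have := leq_mul (leqnn x) l; move: le; clear; lia.
exists (i' - i)%N, (j - j')%N, true; split.
- rewrite lt0n; apply: contra ne; rewrite addn_eq0 !subn_eq0 => /andP[h1 h2].
  by rewrite xpair_eqE -!val_eqE /= !eqn_leq le l h1 h2.
- by apply: sq; apply: leq_trans a3; exact: leq_subr.
- by apply: sq; apply: leq_trans a1; exact: leq_subr.
rewrite -(eqn_modDl (i + x * j')).
have -> : (i + x * j' + (i' - i) = i' + x * j')%N by lia.
have -> : (i + x * j' + x * (j - j') = i + x * j)%N.
  by rewrite mulnBr; have := leq_mul (leqnn x) l; lia.
by rewrite e.
Qed.

(** * Counting roots through short vectors *)

Lemma sqr_form_neq0 (beta : int) (S T : nat) :
  ~ (exists m : int, - beta = m ^+ 2) -> (0 < S + T)%N ->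
  S%:Z ^+ 2 + beta * T%:Z ^+ 2 != 0.
Proof.
move=> nsq ST; apply/eqP => e; have e' : S%:Z ^+ 2 = - beta * T%:Z ^+ 2 by lia.
case: (posnP T) => [T0|T0].
  by move: e'; rewrite T0 expr0n mulr0 => /eqP; rewrite sqrf_eq0; lia.
have : (T%:Z ^+ 2 %| S%:Z ^+ 2)%Z by rewrite e' dvdz_mull.
rewrite dvdzE !abszX /= dvdn_pexp2r // => /dvdnP[u Su].
apply: nsq; exists u%:Z; move: e'; rewrite Su PoszM exprMn.
have : T%:Z ^+ 2 != 0 by rewrite sqrf_eq0; lia.
by move=> /mulIf h /h.
Qed.

Lemma eqn_modMr_gcd (v T x y : nat) : (0 < v)%N ->
  x * T = y * T %[mod v] -> x = y %[mod v %/ gcdn T v].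
Proof.
move=> v0; wlog xy : x y / (x <= y)%N.
  move=> H; have [l|/ltnW l] := leqP x y; first exact: H.
  by move=> e; symmetry; apply: H.
have g0 : (0 < gcdn T v)%N by rewrite gcdn_gt0 v0 orbT.
move=> /esym/eqP; rewrite eqn_mod_dvd ?leq_mul2r ?xy ?orbT // -mulnBl => d.
apply/esym/eqP; rewrite eqn_mod_dvd //.
have eT := divnK (dvdn_gcdl T v); have ev := divnK (dvdn_gcdr T v).
have c : coprime (v %/ gcdn T v) (T %/ gcdn T v).
  have : (gcdn (v %/ gcdn T v) (T %/ gcdn T v) * gcdn T v == 1 * gcdn T v)%N.
    by rewrite muln_gcdl eT ev mul1n gcdnC.
  by rewrite eqn_pmul2r.
rewrite -(@Gauss_dvdl _ _ _ c) -(dvdn_pmul2r g0) ev.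
by rewrite -mulnA eT.
Qed.

(* [thue_rel beta S T b v x]: the root [x] of [X^2 + beta] modulo [v] is attached
   to the short vector [(S, T)], the sign of [S = +- x * T] being given by [b]. *)
Definition thue_rel (beta : int) (S T : nat) (b : bool) (v x : nat) : bool :=
  [&& sqfree v, (x < v)%N, (v %| qval beta x)%N, (0 < S + T)%N,
      (S * S <= v)%N, (T * T <= v)%N &
      if b then S == x * T %[mod v] else (v %| S + x * T)%N].

Definition sqform (beta : int) (S T : nat) : nat :=
  absz (S%:Z ^+ 2 + beta * T%:Z ^+ 2).

(** [S^2 + beta T^2 = (S - x T)(S + x T) + T^2 (x^2 + beta)], and [b] says which linear factor [v]
    divides. *)
Lemma thue_rel_dvd (beta : int) (S T : nat) (b : bool) (v x : nat) :
  thue_rel beta S T b v x -> (v %| sqform beta S T)%N.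
Proof.
move=> /and5P[_ _ vq _ /and3P[_ _ h]].
rewrite -[X in is_true X]/(v%:Z %| S%:Z ^+ 2 + beta * T%:Z ^+ 2)%Z.
have {}h : (v%:Z %| (S%:Z - x%:Z * T%:Z) * (S%:Z + x%:Z * T%:Z))%Z.
  case: b h => h; last by rewrite dvdz_mull // -PoszM -PoszD.
  by rewrite dvdz_mulr // -eqz_mod_dvd -PoszM !modz_nat (eqP h).
have -> : S%:Z ^+ 2 + beta * T%:Z ^+ 2 = (S%:Z - x%:Z * T%:Z) * (S%:Z + x%:Z * T%:Z)
  + T%:Z ^+ 2 * (x%:Z ^+ 2 + beta) by ring.
by rewrite rpredD // dvdz_mull.
Qed.

(** As [S = +- x T] modulo [v], the gcd [g] also divides [S], so [g^2] divides the form. Since [v]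
    is squarefree, [g] is prime to [v / g], and the second factor [g] must divide the cofactor. *)
Lemma thue_rel_gcd (beta : int) (S T : nat) (b : bool) (v x : nat) :
  thue_rel beta S T b v x ->
  (gcdn T v %| sqform beta S T %/ v)%N.
Proof.
move=> /[dup] /thue_rel_dvd d /and5P[sv _ vq _ /and3P[_ _ h]].
have v0 := sqfree_gt0 sv.
set n := sqform _ _ _ in d *; set g := gcdn T v.
have gT : (g %| T)%N by exact: dvdn_gcdl.
have gv : (g %| v)%N by exact: dvdn_gcdr.
have gS : (g %| S)%N.
  have gxT : (g %| x * T)%N by exact: dvdn_mull.
  case: b h => h; last by rewrite -(dvdn_addl _ gxT); exact: dvdn_trans h.
  have := congr1 (modn^~ g) (eqP h); rewrite /= !modn_dvdm // (eqP gxT).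
  by move=> /eqP.
have gg : (g * g %| n)%N.
  rewrite -[X in is_true X]/((g * g)%N%:Z %| S%:Z ^+ 2 + beta * T%:Z ^+ 2)%Z PoszM.
  have /dvdnP[s ->] := gS; have /dvdnP[t ->] := gT; rewrite !PoszM.
  apply/dvdzP; exists (s%:Z ^+ 2 + beta * t%:Z ^+ 2); ring.
have g0 : (0 < g)%N by exact: dvdn_gt0 gv.
have ev : (v %/ g * g = v)%N by rewrite divnK.
have c : coprime g (v %/ g) by apply: sqfree_mul_coprime; rewrite mulnC ev.
rewrite -(@Gauss_dvdl _ _ _ c) -(dvdn_pmul2r g0) -mulnA ev.
by rewrite divnK.
Qed.

(* A root attached to [(S, T)] is recovered from the cofactor [k] of [v] in
   [|S^2 + beta T^2|], which is at most [|beta| + 1], and from the quotient of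
   [x] by [v / gcd(T, v)]; as [v] is squarefree, [gcd(T, v)] divides [k]. *)
Lemma thue_rel_sum_le (beta : int) (S T : nat) (b : bool) (X : nat) :
  ~ (exists m : int, - beta = m ^+ 2) ->
  \sum_(vx : 'I_X.+1 * 'I_X.+1 | thue_rel beta S T b vx.1 vx.2)
    (vx.1%:R^-1 : rat) <=
  (`|beta| + 2)%N%:R ^+ 2 * ((maxn S T)%:R ^+ 2)^-1.
Proof.
move=> nsq; set n := sqform beta S T.
(* The default of [insubd] is never reached under [thue_rel]: by [fE] both coordinates stay below
   [|beta| + 2]. *)
pose f (u : 'I_X.+1 * 'I_X.+1) : 'I_(`|beta| + 2) * 'I_(`|beta| + 2) :=
  let c t : 'I_(`|beta| + 2) := insubd (cast_ord (esym (addn2 _)) ord0) t in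
  (c (n %/ u.1)%N, c (u.2 %/ (u.1 %/ gcdn T u.1))%N).
have fE (u : 'I_X.+1 * 'I_X.+1) : thue_rel beta S T b u.1 u.2 ->
  [/\ ((f u).1 = n %/ u.1 :> nat)%N, ((f u).2 = u.2 %/ (u.1 %/ gcdn T u.1) :> nat)%N,
     (u.1 %| n)%N & (0 < n)%N].
  move=> /[dup] R /[dup] /thue_rel_dvd d /[dup] /thue_rel_gcd gd /and5P[sv xv vq ST /and3P[Sv Tv h]].
  have v0 := sqfree_gt0 sv.
  have n0 : (0 < n)%N by rewrite absz_gt0 sqr_form_neq0.
  have nle : (n <= (`|beta| + 1) * u.1)%N.
    rewrite /n; apply: (@leq_trans (S * S + `|beta| * (T * T))%N).
      have tri (a b' : int) : (absz (a + b')%R <= absz a + absz b')%N by lia.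
      by apply: leq_trans (tri _ _) _; rewrite abszM !abszX /= !mulnn.
    by rewrite mulnDl mul1n addnC; apply: leq_add => //; rewrite leq_mul2l Tv orbT.
  have kle : (n %/ u.1 <= `|beta| + 1)%N.
    by rewrite -(mulnK (`|beta| + 1) v0); exact: leq_div2r.
  have k0 : (0 < n %/ u.1)%N by rewrite divn_gt0 //; exact: dvdn_leq.
  have gk := dvdn_leq k0 gd.
  have gv := dvdn_gcdr T u.1.
  have w0 : (0 < u.1 %/ gcdn T u.1)%N.
    by move: v0; rewrite -{1}(divnK gv) muln_gt0 => /andP[].
  have ql : (u.2 %/ (u.1 %/ gcdn T u.1) < gcdn T u.1)%N.
    by rewrite ltn_divLR // mulnC divnK.
  by rewrite /f /= !val_insubd !ifT; try lia.
apply: (@le_trans _ _ (\sum_(j : 'I_(`|beta| + 2) * 'I_(`|beta| + 2)) ((maxn S T)%:R ^+ 2)^-1)); last first.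
  by rewrite sumr_const card_prod !card_ord -[leLHS]mulr_natl natrM expr2.
apply: (sum_le_inj (f := f)) => [//|u|u u'|j _]; last by rewrite invr_ge0 sqr_ge0.
- move=> /and5P[/sqfree_gt0 v0 _ _ ST /and3P[Sv Tv _]].
  rewrite lef_pV2 ?qualifE /= ?exprn_gt0 ?ltr0n //; last by lia.
  by rewrite -natrX ler_nat -mulnn; have [_|_] := leqP S T.
- move=> R R' e; have [a1 a2 d n0] := fE u R; have [b1 b2 d' _] := fE u' R'.
  rewrite e b1 in a1; rewrite e b2 in a2.
  have ev : u.1 = u'.1 :> nat.
    have k0 : (0 < n %/ u.1)%N by rewrite divn_gt0; [exact: dvdn_leq | exact: dvdn_gt0 d].
    apply/eqP; rewrite -(eqn_pmul2l k0) divnK //; apply/eqP.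
    by rewrite -a1 divnK.
  move: R R'; rewrite /thue_rel -ev => /and5P[/sqfree_gt0 v0 _ _ _ /and3P[_ _ h]].
  move=> /and5P[_ _ _ _ /and3P[_ _ h']].
  have xx : u.2 * T = u'.2 * T %[mod u.1].
    case: b h h' {fE e} => [/eqP <- /eqP <- //|h h'].
    apply/eqP; rewrite -(eqn_modDl S); move: h h'; rewrite /dvdn => /eqP -> /eqP -> //.
  have {}xx := eqn_modMr_gcd v0 xx.
  have ex : u.2 = u'.2 :> nat.
    rewrite (divn_eq u.2 (u.1 %/ gcdn T u.1)) (divn_eq u'.2 (u.1 %/ gcdn T u.1)) xx.
    by rewrite -a2 -ev.
  by apply/pair_eqP => /=; apply/andP; split; apply/eqP/val_inj.
Qed.

(** Split by which variable is larger, counting the diagonal twice: each [S > 0] has [S + 1]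
    partners [T <= S], and [(S+1)/S^2 <= 2/S]. *)
Lemma sum_inv_max_le (N : nat) :
  \sum_(S < N.+1) \sum_(T < N.+1) (((maxn S T)%:R ^+ 2)^-1 : rat) <= 4 * harmonic N.
Proof.
have half : \sum_(S < N.+1) \sum_(T < N.+1 | (T <= S)%N) (S%:R ^+ 2)^-1 <= 2 * harmonic N :> rat.
  rewrite /harmonic mulr_sumr; apply: ler_sum => S _.
  rewrite sumr_const.
  have -> : #|[pred T : 'I_N.+1 | (T <= S)%N]| = S.+1.
    have lt := ltn_ord S; rewrite -sum1_card /= (eq_bigl (fun T : 'I_N.+1 => T < S.+1)%N) //.
    by rewrite -(big_ord_widen N.+1 (fun=> 1%N)) // sum1_card card_ord.
  case: (posnP S) => [->|S0]; first by rewrite expr0n invr0 mul0rn mulr0.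
  have S1 : 1 <= S%:R :> rat by rewrite ler1n.
  rewrite -[leLHS]mulr_natl -[S.+1%:R]natr1 expr2 invfM mulrA ler_wpM2r ?invr_ge0 ?ler0n //.
  rewrite ler_pdivrMr; lra.
apply: (@le_trans _ _ (\sum_(S < N.+1) \sum_(T < N.+1 | (T <= S)%N) (S%:R ^+ 2)^-1 +
    \sum_(S < N.+1) \sum_(T < N.+1 | (S <= T)%N) (T%:R ^+ 2)^-1)).
  rewrite -big_split /=; apply: ler_sum => S _.
  rewrite [X in _ <= X + _]big_mkcond [X in _ <= _ + X]big_mkcond -big_split /=; apply: ler_sum => T _.
  have p (a : nat) : 0 <= (a%:R ^+ 2)^-1 :> rat by rewrite invr_ge0 sqr_ge0.
  have [l|/ltnW l] := leqP S T; rewrite ?l.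
    by rewrite lerDr; case: ifP.
  by rewrite lerDl.
rewrite [X in _ + X <= _](exchange_big_dep predT) //=.
have -> : 4 = 2 + 2 :> rat by [].
by rewrite mulrDl; exact: lerD.
Qed.

(** For [v <= N^2] Thue's vector has [S, T <= N], so the bound per vector can be summed; 8 is 2 for
    the sign [b] times 4 from [sum_inv_max_le]. *)
Lemma root_sum_le (beta : int) (N : nat) :
  ~ (exists m : int, - beta = m ^+ 2) ->
  root_sum beta (N * N) <= 8 * (`|beta| + 2)%N%:R ^+ 2 * harmonic N.
Proof.
move=> nsq; set C : rat := (_ + _)%N%:R ^+ 2.
have C0 : 0 <= C by exact: sqr_ge0.
pose R (u : 'I_(N * N).+1 * 'I_(N * N).+1) (w : 'I_N.+1 * 'I_N.+1 * bool) :=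
  thue_rel beta w.1.1 w.1.2 w.2 u.1 u.2.
apply: (@le_trans _ _ (\sum_u \sum_(w | R u w) u.1%:R^-1)).
  rewrite /root_sum big_mkcond; apply: ler_sum => u _.
  have p0 : 0 <= \sum_(w | R u w) (u.1%:R^-1 : rat).
    by apply: sumr_ge0 => w _; rewrite invr_ge0 ler0n.
  case: ifP => // /and3P[sv xv vq].
  have [S [T [b [ST Sv Tv h]]]] := thue u.2 (sqfree_gt0 sv).
  have vN : (u.1 <= N * N)%N by rewrite -ltnS.
  have SN : (S < N.+1)%N by rewrite ltnS -leq_sqr -!mulnn (leq_trans _ vN).
  have TN : (T < N.+1)%N by rewrite ltnS -leq_sqr -!mulnn (leq_trans _ vN).
  rewrite (bigD1 (Ordinal SN, Ordinal TN, b)) /=; last first.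
    by rewrite /R /thue_rel /= sv xv vq ST Sv Tv h.
  by rewrite lerDl; apply: sumr_ge0 => w _; rewrite invr_ge0 ler0n.
rewrite (exchange_big_dep predT) //=.
apply: (@le_trans _ _ (\sum_(w : 'I_N.+1 * 'I_N.+1 * bool) C * ((maxn w.1.1 w.1.2)%:R ^+ 2)^-1)).
  by apply: ler_sum => w _; exact: thue_rel_sum_le.
rewrite -mulr_sumr -(pair_big predT predT (fun (w : 'I_N.+1 * 'I_N.+1) (b : bool) =>
   ((maxn w.1 w.2)%:R ^+ 2)^-1)) /=.
under eq_bigr do rewrite sumr_const card_bool.
rewrite sumrMnl -(pair_big predT predT (fun (S : 'I_N.+1) (T : 'I_N.+1) =>
   ((maxn S T)%:R ^+ 2)^-1)) /=.
have := sum_inv_max_le N; move: (\sum_(_ < _) _) => Z.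
by move=> h; have := ler_wpM2l C0 h; lra.
Qed.

(** * Inert primes *)

Lemma prod_pfactor_dvd (s : seq nat) (n : nat) : (0 < n)%N -> uniq s ->
  all prime s -> (\prod_(p <- s) p ^ logn p n %| n)%N.
Proof.
move=> n0; elim: s => [|p s IH] /=; first by rewrite big_nil dvd1n.
move=> /andP[ps us] /andP[pp as_]; rewrite big_cons Gauss_dvd ?pfactor_dvdnn ?IH //.
rewrite big_seq; apply: (big_ind (fun m => coprime (p ^ logn p n) m)) => [|a b|q qs].
- exact: coprimen1.
- by rewrite coprimeMr => -> ->.
- apply: coprimeXl; apply: coprimeXr; rewrite prime_coprime // dvdn_prime2 //.
    by apply: contra ps => /eqP ->.
  exact: (allP as_).
Qed.

Lemma prod_pfactor_le (y : nat) (P : pred nat) (n : nat) : (0 < n)%N ->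
  (\prod_(0 <= p < y | prime p && P p) p ^ logn p n <= n)%N.
Proof.
move=> n0; rewrite -big_filter; apply: dvdn_leq => //; apply: prod_pfactor_dvd => //.
  by rewrite filter_uniq // iota_uniq.
by apply/allP => p; rewrite mem_filter => /andP[/andP[]].
Qed.

(** Induction removing the least prime factor; it identifies the squarefree survivors of the sieve
    below. *)
Lemma splitting_primes (beta : int) (v : nat) : sqfree v ->
  (forall p, prime p -> (p %| v)%N -> ~~ (p %| 2 * `|beta|)%N && has_root beta p) ->
  splitting beta v.
Proof.
elim/ltn_ind: v => v IH sv H; have v0 := sqfree_gt0 sv.
have [v1|] := ltnP 1 v; last first.
  move=> v1; have -> : v = 1%N by lia.
  apply/and3P; split; last 1 first.
  - by apply: (@has_rootI _ _ 0) => //; rewrite dvd1n.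
  - apply: sqfree_dvd sv; exact: dvd1n.
  - exact: coprime1n.
have pp := pdiv_prime v1; have pd := pdiv_dvd v; set p := pdiv v in pp pd.
have ev : (p * (v %/ p) = v)%N by rewrite mulnC divnK.
have qd : (v %/ p %| v)%N by rewrite -{2}ev dvdn_mull.
rewrite -ev; apply: splittingM.
- by apply: sqfree_mul_coprime; rewrite ev.
- have /andP[h1 h2] := H p pp pd.
  by rewrite /splitting (sqfree_dvd pd sv) prime_coprime // h1.
- apply: IH; first by rewrite ltn_Pdiv // prime_gt1.
    exact: sqfree_dvd qd sv.
  by move=> q qq qv; apply: H => //; exact: dvdn_trans qd.
Qed.

Definition inert (beta : int) (p : nat) : bool := prime p && ~~ has_root beta p.

(** The inverse of the Euler product of [1 - 1/p]. *)
Definition inert_ratio (beta : int) (N : nat) : rat :=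
  \prod_(0 <= p < N.+1 | inert beta p) (p%:R / p.-1%:R).

(** With [H] the harmonic sum, sieving gives [H <= 4 |beta| P A], while
    [A^2 <= 16 (|beta| + 2)^2 H]. Square the first, insert the second and divide by [H >= 1]; thus
    256 is [4^2 * 16]. *)
Lemma harmonic_le_inert_ratio (beta : int) (N : nat) :
  ~ (exists m : int, - beta = m ^+ 2) -> (0 < N)%N ->
  harmonic N <= (256 * `|beta| ^ 2 * (`|beta| + 2) ^ 2)%N%:R *
    inert_ratio beta N ^+ 2.
Proof.
move=> nsq N0; set P := inert_ratio beta N.
have b0 : (0 < `|beta|)%N.
  by rewrite absz_gt0; apply/eqP => b0; apply: nsq; exists 0; rewrite b0 expr0n oppr0.
pose bad p := (p %| 2 * `|beta|)%N.
pose s := [seq p <- index_iota 0 N.+1 | prime p && (bad p || ~~ has_root beta p)].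
have sp : all prime s by apply/allP => p; rewrite mem_filter => /andP[/andP[]].
have := sift_primes_le N sp; set A0 := \sum_(_ < _ | _) _ => H1.
have P0 : 0 <= P by apply: prodr_ge0 => p _; rewrite divr_ge0.
(* Primes dividing [2 beta] contribute at most [2 |beta|] in all, since [p/(p-1) <= p] is bounded by
   the [p]-part of [2 |beta|]. *)
have Hs : \prod_(p <- s) (p%:R / p.-1%:R) <= (2 * `|beta|)%N%:R * P.
  rewrite big_filter (bigID bad) /=.
  apply: ler_pM; try by apply: prodr_ge0 => p _; rewrite divr_ge0.
    have bb : (0 < 2 * `|beta|)%N by lia.
    have h := prod_pfactor_le N.+1 bad bb.
    apply: (@le_trans _ _ ((\prod_(0 <= p < N.+1 | prime p && bad p) p ^ logn p (2 * `|beta|))%N%:R)); last by rewrite ler_nat.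
    rewrite natr_prod (eq_bigl (fun p => prime p && bad p)); last first.
      by move=> p; case: (bad p); rewrite ?andbF ?andbT.
    apply: ler_prod => p /andP[pp bp]; rewrite divr_ge0 //=.
    have p1 := prime_gt1 pp.
    rewrite ler_pdivrMr; last by rewrite ltr0n; lia.
    rewrite -natrM ler_nat.
    have l1 : (0 < logn p (2 * `|beta|))%N by rewrite logn_gt0 mem_primes pp bb.
    have : (p ^ 1 <= p ^ logn p (2 * `|beta|))%N by rewrite leq_exp2l.
    by rewrite expn1; move: (_ ^ _)%N => e; nia.
  rewrite /P /inert_ratio big_mkcond [leRHS]big_mkcond; apply: ler_prod => p _.
  rewrite /inert; case pp: (prime p) => /=; last by rewrite ?ler01 ?lexx.
  have p1 := prime_gt1 pp.
  have r1 : 1 <= p%:R / p.-1%:R :> rat.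
    by rewrite ler_pdivlMr ?mul1r ?ler_nat ?ltr0n; lia.
  have r0 : 0 <= p%:R / p.-1%:R :> rat by lra.
  by case: (bad p); case: (has_root beta p) => /=; rewrite ?r0 ?r1 ?ler01 ?lexx.
pose A := \sum_(v < N.+1 | splitting beta v) (v%:R^-1 : rat).
have A0' : 0 <= A by apply: sumr_ge0 => v _; rewrite invr_ge0 ler0n.
have H2 : A0 <= 2 * A.
  have := @sum_inv_sqfree_le N (fun n => all (fun p => ~~ (p %| n)%N) s).
  move=> /(_ _)/le_trans; apply.
    move=> a b /allP h; apply/allP => p /h; apply: contra => pb; exact: dvdn_mull.
  apply: ler_wpM2l => //.
  apply: (sum_le_inj (f := id)) => // [v /andP[/allP h sv]|v _]; last by rewrite invr_ge0 ler0n.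
  apply: splitting_primes => // p pp pv.
  have v0 := sqfree_gt0 sv.
  have ps : p \notin s by apply/negP => /h; rewrite pv.
  move: ps; rewrite mem_filter pp mem_index_iota /=.
  have -> : (p < N.+1)%N by apply: leq_ltn_trans (ltn_ord v); exact: dvdn_leq.
  by rewrite andbT negb_or negbK.
have H3 : A ^+ 2 <= 16 * (`|beta| + 2)%N%:R ^+ 2 * harmonic N.
  by have := splitting_sum_sqr_le beta N; have := root_sum_le N nsq; rewrite -/A; lra.
have h1 : 1 <= harmonic N.
  apply: le_trans (harmonic_mono N0).
  by rewrite /harmonic !big_ord_recr big_ord0 /= invr0 invr1 !add0r.
set b : rat := `|beta|%N%:R; have B0 : 0 <= b by exact: ler0n.
have H4 : harmonic N <= 4 * b * P * A.
  apply: (le_trans H1); apply: (@le_trans _ _ ((2 * `|beta|)%N%:R * P * (2 * A))).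
    apply: ler_pM => //; first by apply: prodr_ge0 => p _; rewrite divr_ge0.
    by apply: sumr_ge0 => v _; rewrite invr_ge0 ler0n.
  rewrite natrM -/b; lra.
have H5 : harmonic N ^+ 2 <= (4 * b * P) ^+ 2 * A ^+ 2.
  by rewrite -exprMn ler_sqr ?nnegrE //; [lra | rewrite !mulr_ge0].
have H6 : harmonic N ^+ 2 <= (4 * b * P) ^+ 2 * (16 * (`|beta| + 2)%N%:R ^+ 2 * harmonic N).
  by apply: (le_trans H5); apply: ler_wpM2l => //; exact: sqr_ge0.
rewrite -(@ler_pM2r _ (harmonic N)); last by lra.
rewrite -expr2; apply: (le_trans H6).
rewrite !natrM -/b le_eqVlt; apply/orP; left; apply/eqP; ring.
Qed.

(** * Chebyshev's bound *)

Local Open Scope nat_scope.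

Lemma prod_primes_le (m n x : nat) : 0 < x ->
  (forall p, m <= p < n -> prime p -> p %| x) ->
  \prod_(m <= p < n | prime p) p <= x.
Proof.
move=> x0 H.
have u : uniq [seq p <- index_iota m n | prime p] by rewrite filter_uniq // iota_uniq.
have a : all prime [seq p <- index_iota m n | prime p].
  by apply/allP => p; rewrite mem_filter => /andP[].
apply: leq_trans (dvdn_leq x0 (prod_pfactor_dvd x0 u a)).
rewrite big_filter [X in X <= _]big_seq_cond [X in _ <= X]big_seq_cond.
apply: leq_prod => p /andP[]; rewrite mem_index_iota => pmn pp.
have l1 : 0 < logn p x by rewrite logn_gt0 mem_primes pp x0 H.
by rewrite -{1}(expn1 p) leq_exp2l // prime_gt1.
Qed.

Lemma prime_dvd_fact (p k : nat) : prime p -> p %| k`! -> p <= k.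
Proof.
move=> pp; elim: k => [|k IH]; first by rewrite fact0 Euclid_dvd1.
rewrite factS Euclid_dvdM // => /orP[/dvdn_leq|/IH]; first exact.
exact: leqW.
Qed.

(** Row [2m+1] has two equal central coefficients, and its sum is [2 * 4^m]. *)
Lemma bin_middle_le (m : nat) : 'C(m.*2.+1, m) <= 4 ^ m.
Proof.
have l : m < m.*2.+1 by rewrite -addnn; lia.
have s : 2 ^ m.*2.+1 = \sum_(i < m.*2.+2) 'C(m.*2.+1, i).
  rewrite -[2]/(1 + 1) expnDn; apply: eq_bigr => i _.
  by rewrite !exp1n !muln1.
have l1 : m < m.*2.+2 by lia.
have l2 : m.+1 < m.*2.+2 by lia.
move: s; rewrite (bigD1 (Ordinal l1)) //= (bigD1 (Ordinal l2)) /=; last first.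
  by rewrite -val_eqE /=; lia.
have -> : 'C(m.*2.+1, m.+1) = 'C(m.*2.+1, m).
  by rewrite -bin_sub; [congr 'C(_, _); rewrite -addnn; lia | lia].
have -> : 2 ^ m.*2.+1 = 2 * 4 ^ m by rewrite expnS -mul2n expnM.
lia.
Qed.

(** Erdős's induction: for [n = 2m+1] the primes from [m+2] to [n] all divide ['C(2m+1, m)], and an
    even [n > 2] adds no prime. *)
Lemma primorial_le (n : nat) : \prod_(0 <= p < n.+1 | prime p) p <= 4 ^ n.
Proof.
elim/ltn_ind: n => n IH.
have [n2|n2] := leqP n 2.
  case: n n2 IH => [|[|[|//]]] _ _; first by rewrite unlock.
    by rewrite unlock.
  by rewrite unlock.
case odn: (odd n); last first.
  case: n n2 odn IH => // n n2 odn IH.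
  rewrite big_mkcond big_nat_recr //= -big_mkcond /=.
  have -> : prime n.+1 = false.
    by apply/negP => /even_prime[e|]; [lia | rewrite odn].
  rewrite muln1; apply: leq_trans (IH n _) _ => //.
  by rewrite leq_exp2l.
set m := n./2; have en : n = m.*2.+1 by rewrite -(odd_double_half n) odn.
have m1 : 0 < m by rewrite en -addnn in n2; lia.
rewrite (@big_cat_nat _ _ _ m.+2) //=; last by rewrite en -addnn; lia.
have h1 : \prod_(0 <= p < m.+2 | prime p) p <= 4 ^ m.+1.
  by apply: IH; rewrite en -addnn; lia.
have h2 : \prod_(m.+2 <= p < n.+1 | prime p) p <= 4 ^ m.
  apply: leq_trans (bin_middle_le m).
  apply: prod_primes_le => [|p /andP[p1 p2] pp].
    by rewrite bin_gt0 -addnn; lia.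
  have le : m <= m.*2.+1 by rewrite -addnn; lia.
  have : p %| (m.*2.+1)`! by apply: dvdn_fact; rewrite -en; lia.
  rewrite -(bin_fact le) !Euclid_dvdM // => /orP[//|/orP[] /(prime_dvd_fact pp)]; first lia.
  rewrite -addnn; lia.
apply: leq_trans (leq_mul h1 h2) _.
by rewrite -expnD leq_exp2l // en -addnn; lia.
Qed.

(** This is [y^pi(y) <= 64^y]. Let [s] be the integer square root of [y]. Primes up to [s] cost
    [y^s <= 4^(s^2) <= 4^y], as [y < (s+1)^2 <= 4^s]; primes above [s] have [y <= p^2] and cost the
    square of the primorial. *)
Lemma prod_primes_const_le (y : nat) :
  \prod_(0 <= p < y.+1 | prime p) y <= 64 ^ y.
Proof.
have [s /andP[s1 s2]] := sqrtn_exists y.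
have sy : s <= y by nia.
rewrite (@big_cat_nat _ _ _ s.+1) //=.
have h1 : \prod_(0 <= p < s.+1 | prime p) y <= 4 ^ y.
  apply: (@leq_trans (y ^ s)).
    case: (posnP y) => [y0|y0].
      have -> : s = 0 by nia.
      by rewrite unlock.
    (* The index 0 is not prime; dropping it leaves exactly [s] factors. *)
    rewrite big_mkcond big_nat_recl //= mul1n -[X in _ <= _ ^ X]subn0 -prod_nat_const_nat.
    by apply: leq_prod => p _; case: ifP.
  apply: (@leq_trans ((4 ^ s) ^ s)); last by rewrite -expnM leq_exp2l.
  case: (posnP s) => [-> //|s0]; rewrite leq_exp2r //.
  rewrite -[4]/(2 ^ 2) -expnM mulnC expnM; apply: leq_trans (ltnW s2) _.
  by rewrite mulnn leq_exp2r // ltn_expl.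
have h2 : \prod_(s.+1 <= p < y.+1 | prime p) y <= 4 ^ y * 4 ^ y.
  have h := primorial_le y; rewrite (@big_cat_nat _ _ _ s.+1) //= in h.
  have {}h : \prod_(s.+1 <= p < y.+1 | prime p) p <= 4 ^ y.
    apply: leq_trans h; apply: leq_pmull; apply: prodn_cond_gt0 => p; exact: prime_gt0.
  apply: leq_trans (leq_mul h h); rewrite -big_split /=.
  rewrite [X in X <= _]big_nat_cond [X in _ <= X]big_nat_cond.
  apply: leq_prod => p /andP[/andP[p1 _] _]; nia.
apply: leq_trans (leq_mul h1 h2) _.
by rewrite -!expnMn.
Qed.

Lemma prod_pfactorE (n y : nat) : 0 < n ->
  (forall p, prime p -> p %| n -> p <= y) ->
  n = \prod_(0 <= p < y.+1 | prime p) p ^ logn p n.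
Proof.
move=> n0 H; rewrite -{1}(partnT n0) (widen_partn predT (leq_maxl n y)).
rewrite (@big_cat_nat _ _ _ y.+1) //=; last by rewrite ltnS leq_maxr.
rewrite [X in _ * X]big1_seq ?muln1.
  rewrite [RHS]big_mkcond; apply: eq_bigr => p _; case: ifP => // pp.
  by rewrite lognE pp.
move=> p /andP[_]; rewrite mem_index_iota => /andP[yp _].
rewrite (_ : logn p n = 0) //; apply/eqP; rewrite -leqn0 leqNgt logn_gt0 mem_primes.
by apply/negP => /and3P[pp _ /(H p pp)]; lia.
Qed.

(** * Valuations of the product *)

Lemma sum_logn_fact (p n : nat) : \sum_(0 <= i < n.+1) logn p i = logn p n`!.
Proof.
elim: n => [|n IH]; first by rewrite big_nat1 logn0 fact0 logn1.
by rewrite big_nat_recr //= IH factS lognM ?fact_gt0 // addnC.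
Qed.

Definition dist (i j : nat) : nat := (i - j) + (j - i).

Lemma distC (i j : nat) : dist i j = dist j i.
Proof. exact: addnC. Qed.

(** The distances to [j] are [1..j] on the left and [1..m-1-j] on the right, and [j! (m-1-j)!]
    divides [(m-1)!]. The term [i = j] vanishes because [logn p 0 = 0]. *)
Lemma sum_logn_dist (p m j : nat) : j < m ->
  \sum_(i < m) logn p (dist i j) <= logn p m`!.
Proof.
move=> jm; rewrite -(big_mkord predT (fun i => logn p (dist i j))).
rewrite (@big_cat_nat _ _ _ j) //=; last exact: ltnW.
have -> : \sum_(0 <= i < j) logn p (dist i j) = logn p j`!.
  rewrite big_nat_rev /= add0n -sum_logn_fact big_nat_recl // logn0 add0n.
  rewrite big_nat [RHS]big_nat; apply: eq_bigr => i ij.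
  by rewrite /dist; congr logn; lia.
have -> : \sum_(j <= i < m) logn p (dist i j) = logn p (m.-1 - j)`!.
  rewrite -{1}[j]add0n big_addn -sum_logn_fact.
  have -> : m - j = (m.-1 - j).+1 by lia.
  by apply: eq_bigr => i _; rewrite /dist; congr logn; lia.
rewrite -lognM ?fact_gt0 //; apply: dvdn_leq_log; first exact: fact_gt0.
have jm' : j <= m.-1 by lia.
have d : j`! * (m.-1 - j)`! %| (m.-1)`! by rewrite -(bin_fact jm') dvdn_mull.
apply: (dvdn_trans d); case: m jm {jm' d} => // m _ /=.
by rewrite factS dvdn_mull.
Qed.

(* Erdős's device: outside the term [h i1] of largest [p]-adic valuation, each
   valuation is bounded by that of [h i - h i1]. *)
Lemma sum_logn_max (p m : nat) (S : pred 'I_m) (h : 'I_m -> nat)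
    (w : 'I_m -> 'I_m -> nat) : prime p -> (exists i, S i) ->
  (forall i, S i -> 0 < h i) ->
  (forall d i j, S i -> S j -> i != j -> d %| h i -> d %| h j -> d %| w i j) ->
  (forall i j, i != j -> S i -> S j -> 0 < w i j) ->
  exists2 i1, S i1 & \sum_(i | S i) logn p (h i) <=
    logn p (h i1) + \sum_(i | S i && (i != i1)) logn p (w i i1).
Proof.
move=> pp [i0 Si0] h0 hw w0.
case: (arg_maxnP (fun i => logn p (h i)) Si0) => i1 Si1 mx.
exists i1 => //; rewrite (bigD1 i1) //= leq_add2l; apply: leq_sum => i /andP[Si ne].
rewrite -pfactor_dvdn //; last exact: w0.
apply: hw => //; first exact: pfactor_dvdnn.
by rewrite pfactor_dvdn ?h0 //; exact: mx.
Qed.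

Lemma dist_gt0 (m : nat) (i j : 'I_m) : i != j -> 0 < dist i j.
Proof. by rewrite -val_eqE /dist /=; lia. Qed.

(** Here the differences are [c * dist i j], and [e] is the valuation of the discarded term. The
    predicate [S] lets one index be omitted in the application to [qval]. *)
Lemma sum_logn_progression (p m c A X : nat) (S : pred 'I_m) : prime p -> 0 < c ->
  0 < X -> (forall i, S i -> 0 < A + c * i <= X) ->
  exists2 e, p ^ e <= X &
    \sum_(i | S i) logn p (A + c * i) <= e + m * logn p c + logn p m`!.
Proof.
move=> pp c0 X0 H.
have [/existsP S0|S0] := boolP [exists i, S i]; last first.
  exists 0 => //; rewrite big1 // => i Si.
  by move/existsPn/(_ i): S0; rewrite Si.
have [|d i j _ _ ne di dj|i j ne _ _|i1 S1] :=
  @sum_logn_max p m S (fun i => A + c * i) (fun i j => c * dist i j) pp S0.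
- by move=> i /H /andP[].
- wlog l : i j ne di dj / i <= j.
    move=> W; have [l|/ltnW l] := leqP i j; first exact: W.
    by rewrite distC; apply: (W j i) => //; rewrite eq_sym.
  have -> : c * dist i j = (A + c * j) - (A + c * i).
    by rewrite subnDl -mulnBr /dist (eqP l).
  exact: dvdn_sub.
- by rewrite muln_gt0 c0 dist_gt0.
move=> le; exists (logn p (A + c * i1)).
  have /andP[h1 h2] := H _ S1.
  by apply: leq_trans h2; apply: dvdn_leq => //; exact: pfactor_dvdnn.
apply: (leq_trans le); rewrite -addnA leq_add2l.
apply: (@leq_trans (\sum_(i < m) (logn p c + logn p (dist i i1)))).
  rewrite big_mkcond; apply: leq_sum => i _; case: ifP => // /andP[_ ne].
  by rewrite lognM // dist_gt0.
by rewrite big_split /= sum_nat_const card_ord leq_add2l sum_logn_dist.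
Qed.

Lemma qval_gt0 (beta : int) (k : nat) :
  ~ (exists m : int, (- beta = m ^+ 2)%R) -> 0 < qval beta k.
Proof.
move=> nsq; rewrite /qval absz_gt0.
have := @sqr_form_neq0 beta k 1 nsq; rewrite expr1n mulr1; apply; lia.
Qed.

(** The difference of two values factors as [(k i - k j)(k i + k j)], so after discarding the term
    [i1] the sums [k i + k i1] remain. They again form a progression of step [c], and the device is
    applied a second time. Each discarded term is at most [y^2], whence [y^4]. *)
Lemma sum_logn_qval (beta : int) (p m c k0 y : nat) :
  ~ (exists m : int, (- beta = m ^+ 2)%R) -> prime p -> 0 < c -> 0 < m ->
  k0 + c * m <= y -> `|beta| <= y -> 1 < y ->
  exists2 e, p ^ e <= y ^ 4 &
    \sum_(i < m) logn p (qval beta (k0 + c * i)) <=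
      e + 2 * (m * logn p c) + 2 * logn p m`!.
Proof.
move=> nsq pp c0 m0 ky by_ y1.
pose k (i : 'I_m) := k0 + c * i.
have kinj (i j : 'I_m) : i != j -> k i != k j.
  by rewrite /k eqn_add2l eqn_mul2l -val_eqE => /negbTE ->; lia.
have ky' i : k i < y by apply: leq_trans ky; rewrite /k ltn_add2l ltn_mul2l c0 ltn_ord.
have [||d i j _ _ ne di dj|i j ne _ _|i1 S1] :=
  @sum_logn_max p m predT (fun i => qval beta (k i))
    (fun i j => c * dist i j * (k i + k j)) pp.
- by exists (Ordinal m0).
- by move=> i _; exact: qval_gt0.
- wlog l : i j ne di dj / i <= j.
    move=> W; have [l|/ltnW l] := leqP i j; first exact: W.
    by rewrite distC addnC; apply: (W j i) => //; rewrite eq_sym.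
  have kl : k i <= k j by rewrite leq_add2l leq_mul2l l orbT.
  have -> : c * dist i j = k j - k i.
    by rewrite subnDl -mulnBr /dist (eqP l).
  rewrite -[X in is_true X]/(d%:Z %| ((k j - k i) * (k i + k j))%N%:Z)%Z.
  have -> : (((k j - k i) * (k i + k j))%N%:Z =
     ((k j)%:Z ^+ 2 + beta) - ((k i)%:Z ^+ 2 + beta))%R.
    by rewrite PoszM PoszD -subzn //; ring.
  by apply: rpredB.
- rewrite !muln_gt0 c0 dist_gt0 //=; have := kinj _ _ ne; lia.
move=> le.
have q2 : qval beta (k i1) <= y ^ 2.
  have := ky' i1; rewrite /qval; set K := k i1.
  move=> Ky; have : K * K + y <= y * y by nia.
  rewrite -mulnn; move: (ky'); clear -by_; move=> _; rewrite expr2 -PoszM; lia.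
have [|i /andP[_ ne]|e2 p2 s2] :=
   @sum_logn_progression p m c (k0 + k i1) (y ^ 2) (fun i => true && (i != i1)) pp c0.
- by rewrite expn_gt0; lia.
- have := kinj _ _ ne; have := ky' i; have := ky' i1.
  have : 2 * y <= y ^ 2 by rewrite -mulnn leq_mul2r y1 orbT.
  rewrite /k; move: (c * i) (c * i1) => a b; lia.
exists (logn p (qval beta (k i1)) + e2).
  rewrite expnD (expnD y 2 2); apply: leq_mul => //.
  apply: leq_trans q2; apply: dvdn_leq; [exact: qval_gt0 | exact: pfactor_dvdnn].
apply: (leq_trans le).
have : \sum_(i | predT i && (i != i1)) logn p (c * dist i i1 * (k i + k i1)) <=
   \sum_(i < m) (logn p c + logn p (dist i i1)) +
   \sum_(i < m | true && (i != i1)) logn p (k0 + k i1 + c * i).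
  rewrite [X in _ <= X + _](bigID (fun i => i != i1)) /= addnAC -big_split /=.
  apply: leq_trans (leq_addr _ _); apply: leq_sum => i ne.
  rewrite !lognM ?dist_gt0 // ?muln_gt0 ?c0 ?dist_gt0 //.
    by rewrite leq_add2l /k; apply: eq_leq; congr logn; lia.
  have := kinj _ _ ne; lia.
rewrite big_split /= sum_nat_const card_ord.
have := @sum_logn_dist p m i1 (ltn_ord i1).
move: s2; rewrite /=; set s1 := \sum_(i < m | i != i1) logn p (k0 + _ + _).
set s2 := \sum_(i < m | i != i1) _; set s3 := \sum_(i < m) _.
by move: s1 s2 s3 => s1 s2 s3; lia.
Qed.

(** * Comparison of the product with the squared factorial *)

Lemma prod_expn (I : Type) (r : seq I) (P : pred I) (F : I -> nat) (n : nat) :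
  (\prod_(i <- r | P i) F i) ^ n = \prod_(i <- r | P i) F i ^ n.
Proof. by apply: (big_morph (expn^~ n)) => [a b|]; rewrite ?expnMn ?exp1n. Qed.

(** Since [k^2 <= q + b] with [q = qval beta k] and [b = |beta|] both at least 1, it follows that
    [k^2 <= 2 b q]. The maximum with 1 serves the initial term, where [k] may be 0. *)
Lemma qval_lower (beta : int) (k : nat) :
  ~ (exists m : int, (- beta = m ^+ 2)%R) ->
  maxn 1 (k * k) <= 2 * `|beta| * qval beta k.
Proof.
move=> nsq; have q0 := qval_gt0 k nsq.
have b0 : 0 < `|beta|.
  by rewrite absz_gt0; apply/eqP => b0; apply: nsq; exists 0%R; rewrite b0 expr0n oppr0.
have h : k * k <= qval beta k + `|beta|.
  by rewrite /qval expr2 -PoszM; lia.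
move: h q0 b0; move: (qval beta k) `|beta| (k * k) => q b K h q0 b0.
by rewrite geq_max; apply/andP; split; nia.
Qed.

Lemma fact_sqr_le_prod_qval (beta : int) (k0 c m : nat) :
  ~ (exists m : int, (- beta = m ^+ 2)%R) -> 0 < c ->
  m`! ^ 2 <= \prod_(i < m.+1) (2 * `|beta| * qval beta (k0 + c * i)).
Proof.
move=> nsq c0; elim: m => [|m IH].
  rewrite big_ord1 fact0; have := qval_lower (k0 + c * 0) nsq.
  by rewrite geq_max => /andP[].
rewrite big_ord_recr /= factS expnMn mulnC; apply: leq_mul => //.
have := qval_lower (k0 + c * m.+1) nsq; rewrite geq_max => /andP[_].
apply: leq_trans; rewrite -mulnn; apply: leq_mul; nia.
Qed.

(** Inert primes do not divide the product [G], so it can be multiplied by the inert part [Pi] of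
    [(m!)^2] and still be bounded prime by prime, giving [G Pi <= O(1)^y c^(2m) (m!)^2]. As [(m!)^2]
    is at most [G] up to explicit factors, it cancels. *)
Lemma prod_inert_fact_le (beta : int) (k0 c m y : nat) :
  ~ (exists m : int, (- beta = m ^+ 2)%R) -> 0 < c -> 0 < m ->
  k0 + c * m <= y -> `|beta| <= y -> 1 < y ->
  (forall i p, i < m -> prime p -> p %| qval beta (k0 + c * i) -> p <= y) ->
  \prod_(0 <= p < y.+1 | inert beta p) p ^ (2 * logn p m`!) <=
  m ^ 2 * (2 * `|beta|) ^ m * c ^ (2 * m) * (64 ^ y) ^ 4.
Proof.
move=> nsq c0 m0 ky by_ y1 H.
pose G := \prod_(i < m) qval beta (k0 + c * i).
have G0 : 0 < G by apply: prodn_gt0 => i; exact: qval_gt0.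
have lG p : prime p -> logn p G = \sum_(i < m) logn p (qval beta (k0 + c * i)).
  move=> pp; rewrite /G; apply: (@proj2 (0 < \prod_(i < m) qval beta (k0 + c * i))).
  apply: (big_rec2 (fun a b => 0 < a /\ logn p a = b)); first by rewrite logn1.
  move=> i a b _ [a0 <-]; have q0 := qval_gt0 (k0 + c * i) nsq.
  by rewrite muln_gt0 q0 a0 lognM.
have pG p : prime p -> p %| G -> exists2 i, i < m & p %| qval beta (k0 + c * i).
  move=> pp; rewrite /G Euclid_dvd_prod // big_orE => /existsP[i h].
  by exists i.
have eG : G = \prod_(0 <= p < y.+1 | prime p) p ^ logn p G.
  by apply: prod_pfactorE => // p pp /(pG p pp)[i im]; exact: H.
set Pi := \prod_(0 <= p < y.+1 | inert beta p) _.
have up : G * Pi <= (64 ^ y) ^ 4 * c ^ (2 * m) * m`! ^ 2.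
  have cc : \prod_(0 <= p < y.+1 | prime p) p ^ logn p c <= c.
    by have := prod_pfactor_le y.+1 xpredT c0; under eq_bigl do rewrite andbT.
  have ff : \prod_(0 <= p < y.+1 | prime p) p ^ logn p m`! <= m`!.
    by have := prod_pfactor_le y.+1 xpredT (fact_gt0 m); under eq_bigl do rewrite andbT.
  apply: (@leq_trans (\prod_(0 <= p < y.+1 | prime p)
     (y ^ 4 * (p ^ logn p c) ^ (2 * m) * (p ^ logn p m`!) ^ 2))); last first.
    rewrite 2!big_split /= -!prod_expn.
    apply: leq_mul; first apply: leq_mul.
    - by rewrite leq_exp2r // prod_primes_const_le.
    - by rewrite leq_exp2r //; lia.
    - by rewrite leq_exp2r.
  have -> : Pi = \prod_(0 <= p < y.+1 | prime p) (if has_root beta p then 1 else p ^ (2 * logn p m`!)).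
    rewrite /Pi /inert big_mkcondr /=; apply: eq_bigr => p _; by case: has_root.
  rewrite {1}eG -big_split /=; apply: leq_prod => p pp; have p0 := prime_gt0 pp.
  case: ifP => hr.
    rewrite muln1 lG //.
    have [e pe le] := sum_logn_qval nsq pp c0 m0 ky by_ y1.
    apply: (@leq_trans (p ^ (e + 2 * (m * logn p c) + 2 * logn p m`!))).
      by apply: leq_pexp2l.
    rewrite 2!expnD; apply: leq_mul; last by rewrite -expnM mulnC.
    apply: leq_mul => //; rewrite -expnM.
    by rewrite (_ : 2 * (m * logn p c) = logn p c * (2 * m)) //; lia.
  have -> : logn p G = 0.
    apply/eqP; rewrite -leqn0 leqNgt logn_gt0 mem_primes; apply/negP => /and3P[_ _].
    by move=> /(pG p pp)[i im /(has_rootI p0)]; rewrite hr.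
  rewrite mul1n mulnC expnM; apply: leq_pmull.
  by rewrite muln_gt0 !expn_gt0 p0; lia.
(* The [m] terms only dominate [((m-1)!)^2]; this is the origin of the factor [m^2]. *)
have lo : m`! ^ 2 <= m ^ 2 * ((2 * `|beta|) ^ m * G).
  case: m m0 {ky H G0 lG pG eG up Pi} @G => // m _ G.
  rewrite factS expnMn leq_mul2l; apply/orP; right.
  apply: leq_trans (fact_sqr_le_prod_qval k0 m nsq c0) _.
  by rewrite big_split /= prod_nat_const card_ord.
have f0 : 0 < m`! ^ 2 by rewrite expn_gt0 fact_gt0.
rewrite -(leq_pmul2l f0); apply: (leq_trans (leq_mul lo (leqnn Pi))).
have -> : m ^ 2 * ((2 * `|beta|) ^ m * G) * Pi = m ^ 2 * (2 * `|beta|) ^ m * (G * Pi) by lia.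
apply: leq_trans (leq_mul (leqnn _) up) _; lia.
Qed.

(** * Upper bound for the inert Euler product *)

Lemma bernoulli_le (x : rat) (h : nat) : (0 <= x <= 1)%R ->
  (1 - h%:R * x <= (1 - x) ^+ h)%R.
Proof.
move=> /andP[x0 x1]; elim: h => [|h IH]; first by rewrite mul0r subr0 expr0.
rewrite exprS -natr1.
have hx : (0 <= h%:R * x)%R by rewrite mulr_ge0 // ler0n.
have : ((1 - x) * (1 - h%:R * x) <= (1 - x) * (1 - x) ^+ h)%R.
  by apply: ler_wpM2l => //; lra.
apply: le_trans; nra.
Qed.

(** Bernoulli's inequality at exponent [p] would only give 0 for [(1 - 1/p)^p]. At [h], half of [p]
    rounded up, it gives 1/4, and squaring covers the exponent [p <= 2h]. *)
Lemma prime_ratio_le (p : nat) : 1 < p -> ((p%:R / p.-1%:R) ^+ p <= 16 :> rat)%R.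
Proof.
move=> p1; have p0 : (0 < p%:R :> rat)%R by rewrite ltr0n; lia.
have p2 : (2 <= p%:R :> rat)%R by rewrite ler_nat.
have q0 : (0 < p.-1%:R :> rat)%R by rewrite ltr0n; lia.
have ep : (p.-1%:R = p%:R - 1 :> rat)%R by rewrite -[in RHS](prednK (ltnW p1)) -natr1 addrK.
set t : rat := (p.-1%:R / p%:R)%R.
have t0 : (0 < t)%R by rewrite divr_gt0.
have te : (t = 1 - p%:R^-1)%R by rewrite /t ep mulrBl divff ?mul1r // lt0r_neq0.
have t1 : (t <= 1)%R by rewrite te lerBlDr lerDl invr_ge0 ltW.
set h := uphalf p.
have hh : (2 * h%:R <= p%:R + 1 :> rat)%R.
  by rewrite -natrM natr1 ler_nat /h; lia.
have hp : p <= h + h by rewrite /h; lia.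
have th : (4^-1 <= t ^+ h)%R.
  rewrite te; apply: le_trans (bernoulli_le h _); last first.
    by rewrite invr_ge0 ltW //= invf_le1 //; lra.
  rewrite -subr_ge0.
  have -> : (1 - h%:R / p%:R - 4^-1 = (3 * p%:R - 4 * h%:R) / (4 * p%:R) :> rat)%R.
    by field; lra.
  by rewrite divr_ge0; lra.
have : (16^-1 <= t ^+ p)%R.
  apply: (@le_trans _ _ (t ^+ h * t ^+ h)%R); last by rewrite -exprD ler_wiXn2l // ltW.
  have -> : (16^-1 = 4^-1 * 4^-1 :> rat)%R by [].
  by apply: ler_pM.
rewrite -[(p%:R / p.-1%:R)%R]invrK invf_div -/t exprVn => h16.
by rewrite -[leRHS]invrK lef_pV2 // qualifE /= ?exprn_gt0.
Qed.

(** For [p <= m] and [q = m %/ p], [m <= 2 p q] gives [(p/(p-1))^m <= 16^(2q) <= p^(8q)], and [q] is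
    at most the valuation of [m!]. Hence the [m]-th power of the ratio is at most the fourth power
    of the product over inert primes, which is at most [Z^(4m)]. *)
Lemma inert_ratio_le (beta : int) (k0 c m y L : nat) :
  ~ (exists m : int, (- beta = m ^+ 2)%R) -> 0 < c -> 0 < m ->
  k0 + c * m <= y -> `|beta| <= y -> 1 < y -> y <= L * m ->
  (forall i p, i < m -> prime p -> p %| qval beta (k0 + c * i) -> p <= y) ->
  (inert_ratio beta m <= ((8 * `|beta| * c ^ 2 * 2 ^ (24 * L)) ^ 4)%:R)%R.
Proof.
move=> nsq c0 m0 ky by_ y1 yL H; set Z := 8 * _ * _ * _.
have h := prod_inert_fact_le nsq c0 m0 ky by_ y1 H.
have {}h : \prod_(0 <= p < m.+1 | inert beta p) p ^ (2 * logn p m`!) <= Z ^ m.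
  have my : m <= y by nia.
  apply: leq_trans (leq_trans _ h) _.
    rewrite [X in _ <= X](@big_cat_nat _ _ _ m.+1) //=; apply: leq_pmulr.
    by apply: prodn_cond_gt0 => p /andP[pp _]; rewrite expn_gt0 prime_gt0.
  rewrite /Z (expnM c); move: (c ^ 2) => cc; rewrite !expnMn -!expnM.
  have m4 : m ^ 2 <= 4 ^ m.
    rewrite -[4]/(2 ^ 2) -expnM mulnC expnM leq_exp2r //; apply: ltnW; exact: ltn_expl.
  have -> : 8 ^ m = 4 ^ m * 2 ^ m by rewrite -expnMn.
  have -> : 64 ^ (y * 4) = 2 ^ (24 * y) by rewrite -[64]/(2 ^ 6) -expnM; congr (2 ^ _); lia.
  have l : 2 ^ (24 * y) <= 2 ^ (24 * L * m) by rewrite leq_exp2l // -mulnA leq_mul2l yL orbT.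
  apply: leq_mul => //; apply: leq_mul => //; rewrite -[X in _ <= X]mulnA.
  by apply: leq_mul.
have r0 : (0 <= inert_ratio beta m)%R by apply: prodr_ge0 => p _; rewrite divr_ge0.
rewrite -(@ler_pXn2r _ m) // ?nnegrE ?ler0n //.
apply: (@le_trans _ _ ((\prod_(0 <= p < m.+1 | inert beta p) p ^ (2 * logn p m`!)) ^ 4)%:R); last first.
  by rewrite -natrX ler_nat -expnM mulnC expnM leq_exp2r.
rewrite prod_expn natr_prod /inert_ratio -prodrXl /=.
rewrite [X in (X <= _)%R]big_nat_cond [X in (_ <= X)%R]big_nat_cond.
apply: ler_prod => p /andP[/andP[_ pm] /andP[pp _]]; rewrite exprn_ge0 ?divr_ge0 //=.
have p1 := prime_gt1 pp; have p0 := prime_gt0 pp; rewrite ltnS in pm.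
have r1 : (1 <= p%:R / p.-1%:R :> rat)%R.
  by rewrite ler_pdivlMr ?mul1r ?ler_nat ?ltr0n; lia.
set q := m %/ p.
have q0 : 0 < q by rewrite divn_gt0.
have mq : m <= p * (2 * q).
  by have := ltn_ceil m p0; rewrite -/q; nia.
apply: (@le_trans _ _ ((p%:R / p.-1%:R) ^+ (p * (2 * q)))%R).
  exact: ler_weXn2l.
rewrite exprM; apply: (@le_trans _ _ (16 ^+ (2 * q))%R).
  by rewrite lerXn2r ?nnegrE ?prime_ratio_le // exprn_ge0 //; lra.
have -> : (16 ^+ (2 * q) = (2 ^ (8 * q))%:R :> rat)%R.
  rewrite natrX (_ : 8 * q = 4 * (2 * q)); last lia.
  by rewrite [in RHS]exprM.
rewrite ler_nat; apply: (@leq_trans (p ^ (8 * q))); first by rewrite leq_exp2r // muln_gt0.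
rewrite -expnM leq_exp2l // logn_fact // (big_ltn (m := 1)) //= expn1 -/q; lia.
Qed.

(** * The computable bound *)

(** Both bounds together give [harmonic m <= K] for a constant [K], whereas
    [harmonic (2^(2K+1)) >= K + 1/2]. *)
Lemma progression_length_lt (beta : int) (k0 c m y L : nat) :
  ~ (exists m : int, (- beta = m ^+ 2)%R) -> 0 < c -> 0 < m ->
  k0 + c * m <= y -> `|beta| <= y -> 1 < y -> y <= L * m ->
  (forall i p, i < m -> prime p -> p %| qval beta (k0 + c * i) -> p <= y) ->
  m < 2 ^ (2 * (256 * `|beta| ^ 2 * (`|beta| + 2) ^ 2 *
                (8 * `|beta| * c ^ 2 * 2 ^ (24 * L)) ^ 8)).+1.
Proof.
move=> nsq c0 m0 ky by_ y1 yL H.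
have h1 := harmonic_le_inert_ratio nsq m0.
have h2 := inert_ratio_le nsq c0 m0 ky by_ y1 yL H.
move: h1 h2; set Z := 8 * _ * _ * _; set C := 256 * _ * _; move=> h1 h2.
have r0 : (0 <= inert_ratio beta m)%R by apply: prodr_ge0 => p _; rewrite divr_ge0.
have h3 : (harmonic m <= (C * Z ^ 8)%:R)%R.
  apply: (le_trans h1); rewrite natrM; apply: ler_wpM2l => //.
  rewrite (_ : Z ^ 8 = (Z ^ 4) ^ 2); last by rewrite -expnM.
  by rewrite natrX ler_sqr ?nnegrE.
rewrite ltnNge; apply/negP => /harmonic_mono/(le_trans (harmonic_pow2 _)).
move=> /le_trans/(_ h3); move: (C * Z ^ 8) => K.
by rewrite -natr1 natrM; lra.
Qed.

(** * Recursive codes and the size of the bound *)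

Definition rec_add : recfun := RPrec (RProj 0) (RComp RSucc [:: RProj 1]).

Definition rec_exp2 : recfun :=
  RPrec (RComp RSucc [:: RZero]) (RComp rec_add [:: RProj 1; RProj 1]).

Definition rec_sum (js : seq nat) : recfun :=
  foldr (fun i e => RComp rec_add [:: RProj i; e]) RZero js.

Lemma computes_add (x y : nat) : computes rec_add [:: x; y] (x + y).
Proof.
elim: x => [|x IH]; first by [].
by exists (x + y) => //; exists [:: x + y]; [split | exists (x + y)].
Qed.

Lemma computes_exp2 (n : nat) : computes rec_exp2 [:: n] (2 ^ n).
Proof.
elim: n => [|n IH]; first by exists [:: 0]; [split | exists 0].
exists (2 ^ n) => //; exists [:: 2 ^ n; 2 ^ n]; first by do ?split.
by rewrite expnS mul2n -addnn; exact: computes_add.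
Qed.

Lemma computes_sum (js xs : seq nat) : all (fun i => i < size xs) js ->
  computes (rec_sum js) xs (sumn [seq nth 0 xs i | i <- js]).
Proof.
elim: js => [|i js IH] //= /andP[ix /IH{}IH].
exists [:: nth 0 xs i; sumn [seq nth 0 xs i | i <- js]]; last exact: computes_add.
by do ?split.
Qed.

Definition iter_exp2 (k : nat) (e : recfun) : recfun :=
  iter k (fun e => RComp rec_exp2 [:: e]) e.

Lemma computes_iter_exp2 (k : nat) (e : recfun) (xs : seq nat) (s : nat) :
  computes e xs s -> computes (iter_exp2 k e) xs (iter k (expn 2) s).
Proof.
move=> h; elim: k => //= k IH; exists [:: iter k (expn 2) s]; first by split.
exact: computes_exp2.
Qed.

(** A tower of five twos over [s] replaces the explicit threshold, so only addition and [2^n] need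
    codes. With [X = 2^9 s^4], the threshold is at most [2^(2^(X+2))], and [X + 2] is below a tower
    of three twos over [s]. *)
Lemma iter_exp2_bound (s b c qa qb : nat) : 3 <= s -> b <= s -> c <= s ->
  qa <= s -> qb <= s ->
  2 * (qa * qb * c) * 2 ^ (2 * (256 * b ^ 2 * (b + 2) ^ 2 *
      (8 * b * c ^ 2 * 2 ^ (24 * (s * (2 * (qa * qb * c))))) ^ 8)).+1 <=
  iter 5 (expn 2) s.
Proof.
move=> s3 bs cs qas qbs.
have s2 : s <= 2 ^ s by apply: ltnW; exact: ltn_expl.
have d3 : qa * qb * c <= s ^ 3.
  by rewrite -[3]/(1 + 1 + 1) !expnD !expn1 !leq_mul.
have e1 : b <= 2 ^ s by exact: leq_trans s2.
have e2 : b + 2 <= 2 ^ s.+1 by rewrite expnS; move: e1 s2 s3 bs; clear; lia.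
have e3 : c <= 2 ^ s by exact: leq_trans s2.
have s4 : 3 * 3 * 3 * s <= s ^ 4.
  by rewrite [s ^ 4]expnSr leq_mul2r -[s ^ 3]/(s * (s * s)); clear -s3; nia.
set K := 256 * _ * _ * _.
have KX : K <= 2 ^ (2 ^ 9 * s ^ 4).
  apply: (@leq_trans (2 ^ 8 * (2 ^ s) ^ 2 * (2 ^ s.+1) ^ 2 *
     (2 ^ 3 * 2 ^ s * (2 ^ s) ^ 2 * 2 ^ (24 * (s * (2 * s ^ 3)))) ^ 8)).
    rewrite /K; apply: leq_mul; first by rewrite !leq_mul // leq_exp2r.
    rewrite leq_exp2r //; apply: leq_mul.
      by apply: leq_mul; [exact: leq_mul | rewrite leq_exp2r].
    by rewrite leq_exp2l // !leq_mul2l d3 !orbT.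
  have pw z t : z ^ 8 * (z ^ s) ^ 2 * (z ^ s.+1) ^ 2 * (z ^ 3 * z ^ s * (z ^ s) ^ 2 * z ^ t) ^ 8
      = z ^ (8 + s * 2 + s.+1 * 2 + (3 + s + s * 2 + t) * 8).
    by rewrite !(expnM, expnD).
  rewrite pw leq_exp2l //.
  have -> : s * (2 * s ^ 3) = 2 * s ^ 4 by rewrite mulnCA -expnS.
  move: s4 s3; clear; move: (s ^ 4) => S; lia.
clearbody K; set X := 2 ^ 9 * s ^ 4 in KX.
have X3 : 2 + 3 * s <= 2 ^ X.+1.
  apply: (@leq_trans X); last by apply: ltnW; exact: leq_ltn_trans (leqnSn X) (ltn_expl _ _).
  by rewrite /X -[s ^ 4]/(s * (s * (s * s))); nia.
apply: (@leq_trans (2 ^ (2 ^ X.+2))).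
  have -> : 2 * (qa * qb * c) * 2 ^ (2 * K).+1 = (qa * qb * c) * 2 ^ (2 * K).+2.
    by rewrite [in RHS]expnS; lia.
  apply: (@leq_trans (2 ^ (s * 3) * 2 ^ (2 * K).+2)).
    by rewrite leq_mul2r; apply/orP; right; apply: leq_trans d3 _; rewrite expnM leq_exp2r.
  rewrite -expnD leq_exp2l // expnS.
  by move: X3; rewrite expnS; lia.
rewrite /= !leq_exp2l //.
set w := 2 ^ s.
have w5 : s + 5 <= w.
  have : 8 * (s - 3).+1 <= w.
    by rewrite /w -{2}(subnK s3) expnD mulnC leq_mul2r; exact: ltn_expl.
  lia.
have : 2 * X <= 2 ^ (10 + 4 * s).
  by rewrite expnD /X mulnA leq_mul // mulnC expnM leq_exp2r.
have w32 : 10 + 4 * s < 2 ^ w.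
  have : 32 * (w - 5).+1 <= 2 ^ w.
    have w5' : 5 <= w by lia.
    by rewrite -{2}(subnK w5') expnD mulnC leq_mul2r; exact: ltn_expl.
  lia.
move=> XX; have : 2 ^ (10 + 4 * s) <= 2 ^ (2 ^ w) by rewrite leq_exp2l // ltnW.
have X2 : 2 <= X by move: s4 s3; rewrite /X; clear; move: (s ^ 4) => S; lia.
by move: XX X2; clear; lia.
Qed.

(** * Progressions inside the index set *)

Lemma dvdz_quad_prod (beta : int) (a b : rat) (c d n k p : nat) :
  index_set a b c d n k -> p %| qval beta k ->
  (p%:Z %| quad_prod beta a b c d n)%Z.
Proof.
move=> kI pk; rewrite /quad_prod (fsbigD1 k) //; last exact: finite_index_set.
by rewrite dvdz_mulr // /quad_poly !hornerE.
Qed.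

Lemma ge0_ratE (a : rat) : (0 <= a)%R ->
  (a = `|numq a|%:R / `|denq a|%:R)%R /\ 0 < `|denq a|.
Proof.
move=> a0; have d0 : (0 < denq a)%R by exact: denq_gt0.
split; last by rewrite absz_gt0 lt0r_neq0.
by rewrite !natr_absz !ger0_norm ?numq_ge0 ?(ltW d0) // divq_num_den.
Qed.

(** The progression starts beyond [a n] by at most [c + d]. As [b - a >= 1/(qa qb)], the interval
    has length at least [n/(qa qb)], enough for [d + c + c i]. *)
Lemma progression_inside (na qa nb qb c d n m i : nat) : 0 < qa -> 0 < c ->
  na * qb < nb * qa -> qa * qb * c * (d + 1 + m) <= n -> i <= m ->
  let k := d + c * (na * n %/ (qa * c)).+1 + c * i in
  na * n <= k * qa /\ k * qb <= nb * n.
Proof.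
move=> qa0 c0 ab nm im; set u := na * n %/ (qa * c) => k.
have qc0 : 0 < qa * c by rewrite muln_gt0 qa0.
have lo : u * (qa * c) <= na * n by exact: leq_divM.
have hi : na * n < u.+1 * (qa * c) by exact: ltn_ceil.
split; first by rewrite /k; nia.
rewrite -(leq_pmul2r qa0).
have h1 : k * qb * qa <= qb * (na * n) + qa * qb * (d + c + c * i) by rewrite /k; nia.
apply: (leq_trans h1).
have h2 : qa * qb * (d + c + c * i) <= n.
  apply: leq_trans nm; rewrite -(mulnA (qa * qb)) leq_mul2l; apply/orP; right.
  by rewrite !mulnDr muln1; apply: leq_add; [rewrite leq_add2r leq_pmull | rewrite leq_mul2l im orbT].
apply: (@leq_trans ((na * qb).+1 * n)); first by nia.
by rewrite mulnAC leq_mul2r ab orbT.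
Qed.

(** If no such prime exists, all primes dividing the chosen terms are at most [y = s n], which also
    bounds the terms. With [D = qa qb c] and about [n / D] terms one has [n <= 2 D m], so
    [L = 2 s D] works, and the bound on [m] contradicts the size of [n]. *)
Lemma large_prime_divisor (beta : int) (a b : rat) (c d M n : nat) :
  ~ (exists m : int, (- beta = m ^+ 2)%R) -> (0 <= a)%R -> (a < b)%R -> 0 < c ->
  iter 5 (expn 2) (sumn (encode beta a b c d M)) < n ->
  exists p : nat,
    [/\ prime p, M * n < p & (p%:Z %| quad_prod beta a b c d n)%Z].
Proof.
move=> nsq a0 ab c0; set s := sumn _ => Bn; apply: contrapT => no_p.
have [ea qa0] := ge0_ratE a0; have [eb qb0] := ge0_ratE (le_trans a0 (ltW ab)).
set na := `|numq a| in ea; set qa := `|denq a| in ea qa0.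
set nb := `|numq b| in eb; set qb := `|denq b| in eb qb0.
have ltab : na * qb < nb * qa.
  move: ab; rewrite {1}ea {1}eb ltr_pdivrMr ?ltr0n // mulrAC ltr_pdivlMr ?ltr0n //.
  by rewrite -!natrM ltr_nat.
have b0 : 0 < `|beta|.
  by rewrite absz_gt0; apply/eqP => be; apply: nsq; exists 0%R; rewrite be expr0n oppr0.
have [s3 [bs [cs [ds [Ms [qas [qbs nbs]]]]]]] : 3 <= s /\ `|beta| <= s /\ c <= s /\ d <= s /\
    M <= s /\ qa <= s /\ qb <= s /\ nb <= s.
  rewrite /s /encode /= -/na -/qa -/nb -/qb; move: (nat_of_bool _) => e0.
  by clear -qa0 qb0 c0; lia.
have := iter_exp2_bound s3 bs cs qas qbs; move: Bn; move: (iter 5 _ _) => B Bn.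
set D := qa * qb * c; set K := 256 * _ * _ * _ => KB.
have D0 : 0 < D by rewrite !muln_gt0 qa0 qb0.
(* This makes [n / D >= 2 (d + 2)], so that removing [d + 1] terms costs at most about half of
   them. *)
have K1 : s < K.
  rewrite /K; set Z := 8 * _ * _ * _.
  have Zs : s < Z.
    apply: (@leq_ltn_trans (24 * (s * (2 * D)))); first by rewrite mulnCA leq_pmulr // muln_gt0 muln_gt0 D0.
    apply: leq_trans (ltn_expl _ (ltnSn 1)) _; apply: leq_pmull.
    by rewrite !muln_gt0 b0 c0.
  have Z0 : 0 < Z by exact: leq_ltn_trans Zs.
  apply: (leq_trans Zs); apply: (@leq_trans (Z ^ 8)).
    by rewrite -{1}(expn1 Z) leq_pexp2l.
  by apply: leq_pmull; rewrite !muln_gt0 b0 addn_gt0 b0.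
have KE : K = 256 * `|beta| ^ 2 * (`|beta| + 2) ^ 2 *
  (8 * `|beta| * c ^ 2 * 2 ^ (24 * (s * (2 * D)))) ^ 8 by [].
clearbody K.
have dn : 2 * D * (d + 2) <= n.
  apply: leq_trans (ltnW Bn); apply: leq_trans KB; rewrite leq_mul2l; apply/orP; right.
  apply: leq_trans (ltnW (ltn_expl _ (ltnSn 1))); clear -K1 ds; lia.
pose m := n %/ D - (d + 1).
have q2 : 2 * (d + 2) <= n %/ D by rewrite leq_divRL // mulnAC.
have md : d + 1 + m = n %/ D by rewrite /m subnKC //; clear -q2; lia.
have mdn : D * (d + 1 + m) <= n by rewrite md mulnC leq_divM.
have nD : n <= 2 * D * m.
  have := ltn_ceil n D0; rewrite -md; clearbody m D; clear -q2 md; nia.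
have m0 : 0 < m by rewrite /m; clear -q2; lia.
pose k0 := d + c * (na * n %/ (qa * c)).+1.
have ins i : i <= m -> na * n <= (k0 + c * i) * qa /\ (k0 + c * i) * qb <= nb * n.
  exact: (progression_inside qa0 c0 ltab mdn).
have n0 : 0 < n by exact: leq_ltn_trans Bn.
have km : k0 + c * m <= s * n.
  have [_ h] := ins m (leqnn m); apply: (@leq_trans (nb * n)); last by rewrite leq_mul2r nbs orbT.
  by apply: leq_trans h; rewrite leq_pmulr.
have bn : `|beta| <= s * n by apply: leq_trans bs _; rewrite leq_pmulr.
have y1 : 1 < s * n by clear -s3 n0; nia.
have yL : s * n <= s * (2 * D) * m by rewrite -mulnA leq_mul2l nD orbT.
suff pr i p : i < m -> prime p -> p %| qval beta (k0 + c * i) -> p <= s * n.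
  have := progression_length_lt nsq c0 m0 km bn y1 yL pr.
  rewrite -KE => mK; move: (leq_ltn_trans KB Bn); rewrite ltnNge => /negP; apply.
  apply: (leq_trans nD); rewrite leq_mul2l; apply/orP; right; exact: ltnW.
move=> im pp pq; rewrite leqNgt; apply/negP => np; apply: no_p; exists p; split => //.
  by apply: leq_ltn_trans np; rewrite leq_mul2r Ms orbT.
apply: dvdz_quad_prod pq; have [h1 h2] := ins i (ltnW im); split => /=.
  rewrite {1}ea {1}eb mulrAC ler_pdivrMr ?ltr0n // mulrAC ler_pdivlMr ?ltr0n //.
  by rewrite -!natrM !ler_nat h1 h2.
exists ((na * n %/ (qa * c)).+1 + i) => //.
by rewrite /k0 mulnDr; clear; lia.
Qed.

Local Open Scope ring_scope.

Theorem theorem3p3 :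
  exists bound : recfun,
    forall (beta : int) (a b : rat) (c d M : nat),
      ~ (exists m : int, - beta = m ^+ 2) ->
      0 <= a -> a < b ->
      (0 < c)%N ->
      exists2 B : nat,
        computes bound (encode beta a b c d M) B &
        forall n : nat, (B < n)%N ->
          exists p : nat,
            [/\ prime p, (M * n < p)%N
              & (p%:Z %| quad_prod beta a b c d n)%Z].
Proof.
(* The nine summed positions are all entries of [encode], so the sum dominates every parameter. *)
exists (iter_exp2 5 (rec_sum (iota 0 9))) => beta a b c d M nsq a0 ab c0.
exists (iter 5 (expn 2) (sumn (encode beta a b c d M))).
  by apply: computes_iter_exp2; apply: computes_sum.
by move=> n; exact: large_prime_divisor.
Qed.
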